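(* Let $r\ge3$ be a fixed integer and let $\alpha_1,\dots,\alpha_r$ be fixed real numbers with $\alpha_1,\alpha_2>0$ and $\alpha_{j+2}\ge[(j+2)!-1]\sum_{i=1}^{j+1}\alpha_i$ for $j=1,2,\dots,r-2$. Then $$br\big(C_{2\lfloor\alpha_1 n\rfloor},C_{2\lfloor\alpha_2 n\rfloor},\dots,C_{2\lfloor\alpha_r n\rfloor}\big)=\Big(\sum_{j=1}^r\alpha_j+o(1)\Big)n ,$$ where $o(1)\to0$ as $n\to\infty$.
   Context: $C_m$ denotes the cycle of length $m$. For bipartite graphs $B_1,\dots,B_r$ ($r\ge2$), the bipartite Ramsey number $br(B_1,\dots,B_r)$ is the minimum integer $N$ such that every $r$-edge coloring (with colors $1,\dots,r$) of the complete bipartite graph $K_{N,N}$ contains, for some $i\in\{1,\dots,r\}$, a monochromatic subgraph in color $i$ isomorphic to $B_i$. *)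

(* Defs.v *)
From HB Require Import structures.
From mathcomp Require Import all_boot all_order all_algebra.
From mathcomp Require Import all_classical all_reals all_analysis.

Set Implicit Arguments.
Unset Strict Implicit.
Unset Printing Implicit Defensive.

Record sgraph := SGraph {
  vertex :> finType;
  edge : rel vertex;
  edge_sym : symmetric edge;
  edge_irrefl : irreflexive edge }.

Definition bipartite (G : sgraph) : Prop :=
  exists side : G -> bool, forall u v : G, edge u v -> side u != side v.

(* G has a (not necessarily induced) subgraph isomorphic to H. *)
Definition has_copy (G H : sgraph) : Prop :=
  exists2 f : H -> G, injective f & forall u v : H, edge u v -> edge (f u) (f v).

Section Cycle.
Variable m : nat.

Definition cycle_rel : rel 'I_m :=
  fun u v => (u != v) && ((u.+1 %% m == v) || (v.+1 %% m == u)).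

Lemma cycle_rel_sym : symmetric cycle_rel.
Proof. by move=> u v; rewrite /cycle_rel eq_sym orbC. Qed.

Lemma cycle_rel_irrefl : irreflexive cycle_rel.
Proof. by move=> u; rewrite /cycle_rel eqxx. Qed.

(* The cycle of length m when m >= 3; for m = 2 this is a single edge and for
   m <= 1 it has no edge. *)
Definition cycle_graph : sgraph := SGraph cycle_rel_sym cycle_rel_irrefl.
End Cycle.

Section CompleteBipartite.
Variable N : nat.

Definition Knn_rel : rel ('I_N + 'I_N)%type := fun u v =>
  match u, v with
  | inl _, inr _ | inr _, inl _ => true
  | _, _ => false
  end.

Lemma Knn_rel_sym : symmetric Knn_rel.
Proof. by case=> x; case=> y. Qed.

Lemma Knn_rel_irrefl : irreflexive Knn_rel.
Proof. by case. Qed.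

Definition Knn : sgraph := SGraph Knn_rel_sym Knn_rel_irrefl.
End CompleteBipartite.

(* An edge coloring is a symmetric function of the two endpoints; its values on
   pairs of non-adjacent vertices are irrelevant. *)
Record coloring (G : sgraph) (r : nat) := Coloring {
  color :> G -> G -> 'I_r;
  color_sym : forall u v, color u v = color v u }.

Section ColorClass.
Variables (G : sgraph) (r : nat) (c : coloring G r) (i : 'I_r).

Definition color_rel : rel G := fun u v => edge u v && (c u v == i).

Lemma color_rel_sym : symmetric color_rel.
Proof. by move=> u v; rewrite /color_rel edge_sym color_sym. Qed.

Lemma color_rel_irrefl : irreflexive color_rel.
Proof. by move=> u; rewrite /color_rel edge_irrefl. Qed.

Definition color_class : sgraph := SGraph color_rel_sym color_rel_irrefl.
End ColorClass.

Definition ramsey_arrow (r : nat) (B : 'I_r -> sgraph) (N : nat) : Prop :=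
  forall c : coloring (Knn N) r, exists i : 'I_r, has_copy (color_class c i) (B i).

(* The default value 0 is never used for families of bipartite graphs: see br_min. *)
Definition br (r : nat) (B : 'I_r -> sgraph) : nat :=
  if pselect (exists N, `[< ramsey_arrow B N >]) is left ex then ex_minn ex else 0.

Lemma pigeonhole (A T : finType) (f : A -> T) (s : nat) :
  0 < #|T| -> #|T| * s <= #|A| -> exists t, s <= #|[set a | f a == t]|.
Proof.
move=> T0 sA; apply: contrapT => /forallNP H.
have lts t : #|[set a | f a == t]| < s by rewrite ltnNge; apply/negP/H.
have s0 : 0 < s by have /card_gt0P[t _] := T0; apply: leq_ltn_trans (lts t).
suff : #|A| <= #|T| * s.-1.
  by move=> /(leq_trans sA); rewrite leq_pmul2l// leqNgt prednK// leqnn.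
rewrite -sum1_card (partition_big f predT)//= -sum_nat_const.
apply: leq_sum => t _; rewrite sum1_card -ltnS prednK//.
by apply: leq_ltn_trans (lts t); rewrite cardsE.
Qed.

Lemma ramsey_arrow_exists (r : nat) (B : 'I_r -> sgraph) :
  0 < r -> (forall i, bipartite (B i)) -> exists N, ramsey_arrow B N.
Proof.
move=> r0 bipB; pose s := \sum_i #|B i|; pose m := r * s.
pose N := m + r ^ m * s; exists N => c.
have mN : m <= N by rewrite leq_addr.
pose w (x : 'I_m) : Knn N := inl (widen_ord mN x).
pose F (y : 'I_N) := [ffun x => c (w x) (inr y : Knn N)].
have [||v hv] := @pigeonhole _ _ F s.
- by rewrite card_ffun !card_ord expn_gt0 r0.
- by rewrite card_ffun !card_ord leq_addl.
have [||i hi] := @pigeonhole _ _ v s; rewrite ?card_ord//.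
exists i; have [side hside] := bipB i.
have Bs : #|B i| <= s by rewrite /s (bigD1 i)//= leq_addr.
pose X (u : B i) := enum_val (widen_ord (leq_trans Bs hi) (enum_rank u)).
pose Y (u : B i) := enum_val (widen_ord (leq_trans Bs hv) (enum_rank u)).
have Xinj : injective X by move=> a b /enum_val_inj[] /val_inj/enum_rank_inj.
have Yinj : injective Y by move=> a b /enum_val_inj[] /val_inj/enum_rank_inj.
have cXY a b : c (w (X a)) (inr (Y b) : Knn N) = i.
  have := enum_valP (widen_ord (leq_trans Bs hi) (enum_rank a)).
  have := enum_valP (widen_ord (leq_trans Bs hv) (enum_rank b)).
  rewrite !inE -/(X a) -/(Y b) => /eqP hY /eqP <-.
  by rewrite -hY ffunE.
exists (fun u => if side u then w (X u) else inr (Y u)).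
  move=> a b; case: (side a); case: (side b) => // -[].
    by move=> /val_inj/Xinj.
  exact: Yinj.
move=> a b /hside; rewrite /= /color_rel.
by case: (side a); case: (side b) => //= _; rewrite ?[c (inr _) _]color_sym cXY eqxx.
Qed.

Lemma br_min (r : nat) (B : 'I_r -> sgraph) :
  0 < r -> (forall i, bipartite (B i)) ->
  ramsey_arrow B (br B) /\ forall N, ramsey_arrow B N -> br B <= N.
Proof.
move=> r0 bipB; rewrite /br; case: pselect => [ex|[]]; last first.
  by have [N hN] := ramsey_arrow_exists r0 bipB; exists N; apply/asboolP.
case: ex_minnP => n /asboolP hn hmin; split=> // N hN.
by apply: hmin; apply/asboolP.
Qed.

Lemma bipartite_even_cycle (k : nat) : bipartite (cycle_graph (2 * k)).
Proof.
exists (fun u : 'I_(2 * k) => odd u) => u v /andP[_].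
have odd2k : odd (2 * k) = false by rewrite mul2n odd_double.
by case/orP => /eqP <-; rewrite odd_mod//=; case: (odd _).
Qed.

(* Main.v *)
Require Import Defs.
From HB Require Import structures.
From mathcomp Require Import all_boot all_order all_algebra.
From mathcomp Require Import zify lra.
From mathcomp Require Import boolp.

Set Implicit Arguments.
Unset Strict Implicit.
Unset Printing Implicit Defensive.

(** Lower bound: give the left vertices colours so that colour [i] is used on
    fewer than [a_i] of them; a cycle of length [2 a_i] has [a_i] left vertices.

    Upper bound, by induction on the number of colours. Call a pair [(A, B)] lower
    regular in a colour if no large sub-pair is sparse. Paths of any prescribed even
    length run through such a pair, so many disjoint pairs lying in one robustly
    connected set [U] can be strung together, along boundedly many short links fixed
    beforehand, into a cycle of exactly the required length. Dense pairs contain lower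
    regular ones by density increment, so it is enough to pack pairs while the
    uncovered part of [U] is dense, and to augment along paths of length three.
    If the last colour is dense on every [M x M] rectangle, with
    [M] slightly above the sum of the smaller [a_i] and [4 M <= N], the packing covers
    [N - M] vertices on each side; otherwise some [M x M] rectangle is almost free of
    that colour and the induction applies there. With two colours, grow a connected set
    [U] in the first one: either it covers almost a whole side, or the second colour is
    almost complete on the two rectangles between [U] and its complement. No regularity
    partition is needed.

    All smallness conditions are stated in [nat]: a quantity is at most [x / h] when
    its product with [h] is at most [x]. *)

(** * Edge counts *)

(** A regularity partition would supply clusters of equal size and a reduced graph whose maximum
    matching could be analysed. Here regular pairs are found one at a time, at different scales, so
    every class of a packing carries its own threshold, and what matters is that the sum of the
    thresholds is small compared with [N]. Maximality under augmentation then takes the place of the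
    vertex cover argument for bipartite matchings.

    The condition [4 M <= N] serves twice: it makes a set with sparse boundary either small or
    almost everything on both sides, and it closes the final count of matched pairs. It comes from
    the growth of the [alpha]s in the form [a_k >= 4 * (a_0 + ... + a_(k-1))]: since
    [(k+1)! - 1 >= 5], one of five units is free to absorb the rounding.

    Throughout, [1/h] bounds from below both the relative half-lengths and the slack, and [1/g] is
    the density of missing edges. The order of the quantifiers on these constants is essential: a
    boundary can be made sparse relative to a component size only if the size bound is fixed
    first. *)

Section Sums.
Variable V : finType.
Implicit Types (w : V -> nat) (S T A B : {set V}).

(** Deleting an element of least weight does not lower the average; repeat until [k] elements
    remain. *)
Lemma subset_heavy w S k : k <= #|S| ->
  exists A, [/\ A \subset S, #|A| = k &
    k * \sum_(x in S) w x <= #|S| * \sum_(x in A) w x].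
Proof.
elim: {S}(#|S| - k) {-2}S (erefl (#|S| - k)) => [|n IHn] S nE kS.
  by exists S; split=> //; have -> : k = #|S| by lia.
have /card_gt0P[x0 x0S] : 0 < #|S| by lia.
have [x xS xmin] : exists2 x, x \in S & forall y, y \in S -> w x <= w y.
  by case: (arg_minnP w x0S) => x xS xmin; exists x.
have cS : #|S| = (#|S :\ x|).+1 by rewrite (cardsD1 x) xS.
have [||A [AS Ak kA]] := IHn (S :\ x); [lia..|].
exists A; split=> //; first exact: subset_trans AS (subD1set _ _).
have wx : #|S| * w x <= \sum_(y in S) w y.
  by rewrite -sum_nat_const leq_sum.
have sS : \sum_(y in S) w y = w x + \sum_(y in S :\ x) w y.
  by rewrite (big_setD1 x).
have [k0|k0] := posnP k; first by rewrite k0.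
have s0 : 0 < #|S :\ x| by lia.
have : #|S :\ x| * (k * \sum_(y in S) w y) <= #|S :\ x| * (#|S| * \sum_(y in A) w y).
  have -> : #|S :\ x| * (k * \sum_(y in S) w y) =
            k * (#|S :\ x| * \sum_(y in S) w y) by lia.
  have h : #|S :\ x| * \sum_(y in S) w y <= #|S| * \sum_(y in S :\ x) w y by nia.
  by nia.
by rewrite leq_pmul2l.
Qed.

Lemma subset_light w S k : k <= #|S| ->
  exists A, [/\ A \subset S, #|A| = k &
    #|S| * \sum_(x in A) w x <= k * \sum_(x in S) w x].
Proof.
move=> kS; have [|A [AS Ak h]] := @subset_heavy w S (#|S| - k); first by lia.
exists (S :\: A); have sA : #|S :\: A| = k by rewrite cardsD (setIidPr AS); lia.
split=> //; first exact: subsetDl.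
have -> : \sum_(x in S) w x = \sum_(x in A) w x + \sum_(x in S :\: A) w x.
  by rewrite (big_setID A)/= (setIidPr AS).
move: h; have -> : \sum_(x in S) w x = \sum_(x in A) w x + \sum_(x in S :\: A) w x.
  by rewrite (big_setID A)/= (setIidPr AS).
nia.
Qed.

Lemma subset_card S k : k <= #|S| -> exists2 A : {set V}, A \subset S & #|A| = k.
Proof. by move=> /(subset_heavy (fun=> 0))[A []]; exists A. Qed.

End Sums.

Section Edges.
Variables (V : finType) (G : rel V).
Implicit Types (S T A B : {set V}).

Definition deg T x := #|[set y in T | G x y]|.
Definition edges S T := \sum_(x in S) deg T x.

Lemma degE T x : deg T x = \sum_(y in T) G x y.
Proof.
rewrite /deg -sum1_card [RHS](bigID (G x))/= [X in _ = _ + X]big1 ?addn0.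
  by apply: eq_big => y; rewrite inE; [|case/andP=> _ ->].
by move=> y /andP[_ /negbTE->].
Qed.

Lemma deg_le T x : deg T x <= #|T|.
Proof. by apply: subset_leq_card; apply/subsetP => y; rewrite inE => /andP[]. Qed.

Lemma deg_subset T T' x : T \subset T' -> deg T x <= deg T' x.
Proof.
move=> /subsetP TT'; apply: subset_leq_card; apply/subsetP => y.
by rewrite !inE => /andP[/TT' -> ->].
Qed.

Lemma deg_setD T F x : deg T x <= deg (T :\: F) x + #|F|.
Proof.
have -> : deg T x = #|[set y in T :\: F | G x y] :|: [set y in T :&: F | G x y]|.
  by rewrite /deg; apply: eq_card => y; rewrite !inE; case: (y \in F); rewrite ?andbF ?orbF ?andbT.
apply: leq_trans (leq_card_setU _ _) _; rewrite leq_add2l subset_leq_card//.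
by apply/subsetP => y; rewrite !inE => /andP[/andP[]].
Qed.

Lemma edges_le S T : edges S T <= #|S| * #|T|.
Proof. by rewrite /edges -sum_nat_const leq_sum// => x _; exact: deg_le. Qed.

Lemma edges_subset S S' T T' : S \subset S' -> T \subset T' ->
  edges S T <= edges S' T'.
Proof.
move=> SS' TT'; rewrite /edges [leqRHS](big_setID S)/= (setIidPr SS').
apply: leq_trans (leq_addr _ _).
by apply: leq_sum => x _; exact: deg_subset.
Qed.

Lemma edgesUl A B T : [disjoint A & B] ->
  edges (A :|: B) T = edges A T + edges B T.
Proof.
move=> dAB; rewrite /edges -bigU//=.
by apply: eq_bigl => x; rewrite !inE.
Qed.

Lemma edgesUl_le A B T : edges (A :|: B) T <= edges A T + edges B T.
Proof.
have -> : A :|: B = A :|: (B :\: A).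
  by apply/setP => x; rewrite !inE; case: (x \in A).
rewrite edgesUl; first by rewrite leq_add2l edges_subset ?subsetDl.
by rewrite disjoint_sym -setI_eq0 setDE -setIA (setIC _ A) setICr setI0.
Qed.

Hypothesis symG : symmetric G.

Lemma edgesC S T : edges S T = edges T S.
Proof.
rewrite /edges (eq_bigr _ (fun x _ => degE T x)) exchange_big/=.
by apply: eq_bigr => y _; rewrite degE; apply: eq_bigr => x _; rewrite symG.
Qed.

Lemma edgesUr S A B : [disjoint A & B] ->
  edges S (A :|: B) = edges S A + edges S B.
Proof. by move=> dAB; rewrite 3!(edgesC S) edgesUl. Qed.

Lemma edgesUr_le S A B : edges S (A :|: B) <= edges S A + edges S B.
Proof. by rewrite 3!(edgesC S) edgesUl_le. Qed.

Lemma edges_heavy S T k : k <= #|S| -> k <= #|T| ->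
  exists A B, [/\ A \subset S, B \subset T, #|A| = k, #|B| = k &
    k * k * edges S T <= #|S| * #|T| * edges A B].
Proof.
move=> kS kT; have [A [AS Ak hA]] := subset_heavy (deg T) kS.
have [B [BT Bk hB]] := subset_heavy (deg A) kT.
exists A, B; split=> //; rewrite -/(edges _ _) in hA hB *.
move: hA hB; rewrite -![\sum_(x in _) _]/(edges _ _) !(edgesC _ A).
nia.
Qed.

Lemma edges_light S T k : k <= #|S| -> k <= #|T| ->
  exists A B, [/\ A \subset S, B \subset T, #|A| = k, #|B| = k &
    #|S| * #|T| * edges A B <= k * k * edges S T].
Proof.
move=> kS kT; have [A [AS Ak hA]] := subset_light (deg T) kS.
have [B [BT Bk hB]] := subset_light (deg A) kT.
exists A, B; split=> //.
move: hA hB; rewrite -![\sum_(x in _) _]/(edges _ _) !(edgesC _ A).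
nia.
Qed.

(* The threshold [t] is absolute rather than a fraction of [#|A|], so that the property
   passes to all sub-pairs. *)
Definition lower_reg h t A B :=
  forall A' B', A' \subset A -> B' \subset B -> t <= #|A'| -> t <= #|B'| ->
  #|A'| * #|B'| <= h * edges A' B'.

Lemma lower_regC h t A B : lower_reg h t A B -> lower_reg h t B A.
Proof. by move=> r A' B' *; rewrite edgesC mulnC r. Qed.

Lemma lower_reg_sub h t t' A A' B B' : t <= t' -> A' \subset A -> B' \subset B ->
  lower_reg h t A B -> lower_reg h t' A' B'.
Proof.
move=> tt' sA sB r A1 B1 sA1 sB1 tA tB.
by apply: r; [exact: subset_trans sA1 sA|exact: subset_trans sB1 sB|lia..].
Qed.

End Edges.

(** * Lower regular pairs *)

(** Put [Q = p.+1 * p.+1]. The three bounds on [e2], [e3], [e4] sum to less than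
    [(2Q + t + 1)(Q - 1) s^2], so the total leaves more than [(Q + t + 1) s^2] for [2 h Q e1],
    whereas sparsity of the first block allows only [Q s^2]. *)
Lemma density_incr_arith p t s h e1 e2 e3 e4 : 0 < s ->
  (2 * (p.+1 * p.+1) + t) * (p.+1 * s * (p.+1 * s)) <=
     2 * h * (p.+1 * p.+1) * (e1 + e2 + (e3 + e4)) ->
  2 * h * (p.+1 * p.+1) * e2 < (2 * (p.+1 * p.+1) + t.+1) * (s * (p * s)) ->
  2 * h * (p.+1 * p.+1) * e3 < (2 * (p.+1 * p.+1) + t.+1) * (p * s * s) ->
  2 * h * (p.+1 * p.+1) * e4 < (2 * (p.+1 * p.+1) + t.+1) * (p * s * (p * s)) ->
  2 * h * e1 <= s * s -> False.
Proof.
move=> s0.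
have -> : p.+1 * s * (p.+1 * s) = p.+1 * p.+1 * (s * s) by lia.
have -> : s * (p * s) = p * (s * s) by lia.
have -> : p * s * s = p * (s * s) by lia.
have -> : p * s * (p * s) = p * p * (s * s) by lia.
have {s0} : 0 < s * s by rewrite muln_gt0 s0.
set ss := s * s; move: ss => ss ss0 H0 H2 H3 H4 H1.
have H1' : p.+1 * p.+1 * (2 * h * e1) <= p.+1 * p.+1 * ss by rewrite leq_mul2l H1 orbT.
nia.
Qed.

Lemma ratio_trans a b x y e f : 0 < x -> a * x <= b * e -> y * e <= x * f ->
  a * y <= b * f.
Proof.
move=> x0 h1 h2; rewrite -(leq_pmul2l x0).
have : y * (a * x) <= y * (b * e) by rewrite leq_mul2l h1 orbT.
have : b * (y * e) <= b * (x * f) by rewrite leq_mul2l h2 orbT.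
clear; lia.
Qed.

Section LowerReg.
Variables (V : finType) (G : rel V).
Hypothesis symG : symmetric G.
Implicit Types (S T A B : {set V}).

(* If the pair is not regular, a sparse [m q^j x m q^j] sub-pair forces one of the other
   three blocks to have density larger by [1 / (2 h q^2)]. *)
Lemma lower_reg_incr h q m j t S T : 0 < h -> 1 < q -> 0 < m ->
  #|S| = m * q ^ j -> #|T| = m * q ^ j ->
  (2 * q ^ 2 + t) * (#|S| * #|T|) <= 2 * h * q ^ 2 * edges G S T ->
  2 * h * q ^ 2 <= t + j ->
  exists2 i, i < j & exists A B, [/\ A \subset S, B \subset T,
    #|A| = m * q ^ i.+1, #|B| = m * q ^ i.+1 & lower_reg G (2 * h) (m * q ^ i) A B].
Proof.
move=> h0 q1 m0; elim: j t S T => [|j IHj] t S T cS cT dST tj.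
  (* With no scale left, [t >= 2 h q^2], and the density [(2 q^2 + t) / (2 h q^2)] would exceed
     one. *)
  have := edges_le G S T; move: dST tj.
  have : 0 < #|S| * #|T| by rewrite cS cT expn0 muln1 muln_gt0 m0.
  have : 0 < q ^ 2 by rewrite expn_gt0 (ltnW q1).
  clear; move: (#|S| * #|T|) (edges _ _ _) (q ^ 2) => x e Q Q0 x0.
  rewrite addn0 => h1 h2 h3.
  have h4 : 2 * h * Q * e <= t * x by rewrite leq_mul.
  have : 0 < Q * x by rewrite muln_gt0 Q0.
  lia.
set s := m * q ^ j in IHj *.
have s0 : 0 < s by rewrite /s muln_gt0 m0 expn_gt0 (ltnW q1).
have cSs : #|S| = q * s by rewrite cS expnS /s mulnCA.
have cTs : #|T| = q * s by rewrite cT expnS /s mulnCA.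
have [reg|] := pselect (lower_reg G (2 * h) s S T).
  by exists j => //; exists S, T; split.
move=> /existsNP[A' /existsNP[B' /not_implyP[A'S /not_implyP[B'T]]]].
move=> /not_implyP[sA' /not_implyP[sB' /negP]]; rewrite -ltnNge => sparse.
have [A1 [B1 [A1A' B1B' cA1 cB1 lA1B1]]] := edges_light symG sA' sB'.
have e11 : 2 * h * edges G A1 B1 <= s * s.
  have x0 : 0 < #|A'| * #|B'|.
    by rewrite muln_gt0 (leq_trans s0 sA') (leq_trans s0 sB').
  rewrite -(leq_pmul2l x0).
  have : s * s * (2 * h * edges G A' B') <= s * s * (#|A'| * #|B'|).
    by rewrite leq_mul2l (ltnW sparse) orbT.
  have := leq_mul (leqnn (2 * h)) lA1B1.
  clear; lia.
have A1S := subset_trans A1A' A'S; have B1T := subset_trans B1B' B'T.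
set A2 := S :\: A1; set B2 := T :\: B1.
have cA2 : #|A2| = q * s - s by rewrite cardsD (setIidPr A1S) cSs cA1.
have cB2 : #|B2| = q * s - s by rewrite cardsD (setIidPr B1T) cTs cB1.
have step (P Q : {set V}) : P \subset S -> Q \subset T -> s <= #|P| -> s <= #|Q| ->
    (2 * q ^ 2 + t.+1) * (#|P| * #|Q|) <= 2 * h * q ^ 2 * edges G P Q ->
    exists2 i, i < j.+1 & exists A B, [/\ A \subset S, B \subset T,
    #|A| = m * q ^ i.+1, #|B| = m * q ^ i.+1 & lower_reg G (2 * h) (m * q ^ i) A B].
  move=> PS QT sP sQ dPQ.
  have [P' [Q' [P'P Q'Q cP' cQ' hPQ]]] := edges_heavy symG sP sQ.
  have [||||i ij [A [B [AP BQ cA cB reg]]]] := IHj t.+1 P' Q' => //.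
  - have x0 : 0 < #|P| * #|Q|.
      by rewrite muln_gt0 (leq_trans s0 sP) (leq_trans s0 sQ).
    by rewrite cP' cQ'; exact: ratio_trans x0 dPQ hPQ.
  - by rewrite addSnnS.
  exists i; first exact: ltnW.
  exists A, B; split => //.
    by apply: subset_trans (subset_trans AP P'P) PS.
  by apply: subset_trans (subset_trans BQ Q'Q) QT.
have A2S : A2 \subset S by exact: subsetDl.
have B2T : B2 \subset T by exact: subsetDl.
(* All four blocks have sides at least [s], so a denser one can be cut down to an [s x s] pair
   without losing density. *)
have sq : s <= q * s - s by rewrite -{3}(mul1n s) -mulnBl leq_pmull// subn_gt0.
have sA2 : s <= #|A2| by rewrite cA2.
have sB2 : s <= #|B2| by rewrite cB2.
have sA1 : s <= #|A1| by rewrite cA1.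
have sB1 : s <= #|B1| by rewrite cB1.
have [h12|h12] := leqP ((2 * q ^ 2 + t.+1) * (#|A1| * #|B2|)) (2 * h * q ^ 2 * edges G A1 B2).
  exact: (step A1 B2).
have [h21|h21] := leqP ((2 * q ^ 2 + t.+1) * (#|A2| * #|B1|)) (2 * h * q ^ 2 * edges G A2 B1).
  exact: (step A2 B1).
have [h22|h22] := leqP ((2 * q ^ 2 + t.+1) * (#|A2| * #|B2|)) (2 * h * q ^ 2 * edges G A2 B2).
  exact: (step A2 B2).
exfalso.
have dA : [disjoint A1 & A2] by rewrite -setI_eq0 /A2 setDE setICA setICr setI0.
have dB : [disjoint B1 & B2] by rewrite -setI_eq0 /B2 setDE setICA setICr setI0.
have eST : edges G S T = edges G A1 B1 + edges G A1 B2 + (edges G A2 B1 + edges G A2 B2).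
  rewrite -!edgesUr// -edgesUl//.
  by congr edges; apply/setP => x; rewrite !inE;
     [have := subsetP A1S x|have := subsetP B1T x]; case: (x \in _) => //= ->.
move: dST h12 h21 h22 e11; rewrite eST cSs cTs cA1 cB1 cA2 cB2.
set e1 := edges _ A1 B1; set e2 := edges _ A1 B2.
set e3 := edges _ A2 B1; set e4 := edges _ A2 B2.
have [p pE] : exists p, q = p.+1 by exists q.-1; rewrite prednK// ltnW.
have -> : q * s - s = p * s by rewrite pE mulSn addKn.
have -> : q ^ 2 = p.+1 * p.+1 by rewrite pE expnS expn1.
rewrite pE; exact: density_incr_arith.
Qed.

(** The scale [i] is not controlled, but the sides are exactly [q] times the threshold: [q] decides
    which fraction of the pair is lost when paths are built in it. *)
Lemma lower_reg_subpair h q m S T : 0 < h -> 1 < q -> 0 < m ->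
  let J := 2 * h * q ^ 2 in
  m * q ^ J <= #|S| -> m * q ^ J <= #|T| ->
  #|S| * #|T| <= h * edges G S T ->
  exists2 i, i < J & exists A B, [/\ A \subset S, B \subset T,
    #|A| = m * q ^ i.+1, #|B| = m * q ^ i.+1 & lower_reg G (2 * h) (m * q ^ i) A B].
Proof.
move=> h0 q1 m0 J sS sT dST.
have [S' [T' [S'S T'T cS' cT' hST]]] := edges_heavy symG sS sT.
have [||i iJ [A [B [AS' BT' cA cB reg]]]] :=
    @lower_reg_incr h q m J 0 S' T' h0 q1 m0 cS' cT'.
- have mq0 : 0 < m * q ^ J by rewrite muln_gt0 m0 expn_gt0 (ltnW q1).
  have x0 : 0 < #|S| * #|T|.
    by rewrite muln_gt0 (leq_trans mq0 sS) (leq_trans mq0 sT).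
  rewrite addn0 cS' cT'.
  have := ratio_trans (a := 1) x0 _ hST; rewrite mul1n => /(_ h dST).
  rewrite mul1n => /(leq_mul (leqnn (2 * q ^ 2))).
  clear; lia.
- by rewrite add0n.
exists i => //; exists A, B; split=> //; first exact: subset_trans AS' S'S.
exact: subset_trans BT' T'T.
Qed.

End LowerReg.

(** * Short connections and long paths through a lower regular pair *)

Section RegularPairs.
Variables (V : finType) (G : rel V).
Hypothesis symG : symmetric G.
Implicit Types (S T A B F U P Q Z : {set V}).

Lemma card_setD_le A F : #|A| <= #|A :\: F| + #|F|.
Proof. by rewrite -(cardsID F A) addnC leq_add2l subset_leq_card// subsetIr. Qed.

(** Otherwise the vertices of low degree would form a forbidden sparse sub-pair with [B]. *)
Lemma few_low_deg h t k A B : lower_reg G h t A B -> 0 < t -> t <= #|B| ->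
  h * k <= #|B| -> #|[set a in A | deg G B a < k]| < t.
Proof.
move=> reg t0 tB kB; rewrite ltnNge; apply/negP => tA.
set A' := [set a in A | _] in tA.
have A'A : A' \subset A by apply/subsetP => x; rewrite inE => /andP[].
have := reg A' B A'A (subxx _) tA tB; apply/negP; rewrite -ltnNge.
have [k0|k0] := posnP k.
  move: tA; suff -> : A' = set0 by rewrite cards0 leqNgt t0.
  by apply/setP => x; rewrite !inE k0 ltn0 andbF.
have le : edges G A' B <= #|A'| * k.-1.
  rewrite -sum_nat_const; apply: leq_sum => x; rewrite inE => /andP[_].
  by case: (k) k0.
have A0 : 0 < #|A'| := leq_trans t0 tA.
rewrite -(prednK k0) in kB.
have [h0|h0] := posnP h; first by rewrite h0 mul0n muln_gt0 A0 (leq_trans t0 tB).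
have := leq_mul (leqnn h) le; have := leq_mul (leqnn #|A'|) kB.
have : 0 < h * #|A'| by rewrite muln_gt0 h0.
move: k.-1 => p; clear; lia.
Qed.

Lemma lower_reg_nbr h t A B A' B' : lower_reg G h t A B -> 0 < h -> 0 < t ->
  A' \subset A -> B' \subset B -> t <= #|A'| -> h * t <= #|B'| ->
  exists2 a, a \in A' & t <= deg G B' a.
Proof.
move=> reg h0 t0 A'A B'B tA tB.
have tB' : t <= #|B'| by apply: leq_trans tB; rewrite leq_pmull.
have := few_low_deg (lower_reg_sub (leqnn t) A'A B'B reg) t0 tB' tB.
move=> /leq_trans/(_ tA) lt; apply: contrapT => none.
suff : A' \subset [set a in A' | deg G B' a < t].
  by move=> /subset_leq_card; rewrite leqNgt lt.
apply/subsetP => a aA; rewrite inE aA ltnNge; apply/negP => ta.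
by apply: none; exists a.
Qed.

Lemma lower_reg_edge h t A B A' B' : lower_reg G h t A B -> 0 < t ->
  A' \subset A -> B' \subset B -> t <= #|A'| -> t <= #|B'| ->
  exists a b, [/\ a \in A', b \in B' & G a b].
Proof.
move=> reg t0 A'A B'B tA tB; have := reg _ _ A'A B'B tA tB.
apply: contraPP => none; apply/negP; rewrite -ltnNge.
suff -> : edges G A' B' = 0.
  by rewrite muln0 muln_gt0 (leq_trans t0 tA) (leq_trans t0 tB).
rewrite /edges big1// => a aA; apply/eqP; rewrite cards_eq0.
apply/eqP/setP => b; rewrite !inE; apply/negP => /andP[bB Gab].
by apply: none; exists a, b.
Qed.

(* The set [F] will hold the links already chosen, whose number is bounded. *)
Definition linked D f U := forall F, #|F| <= f ->
  forall u v, u \in U -> v \in U -> u \notin F -> v \notin F ->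
  exists p, [/\ path G u p, last u p = v, size p <= D & all (fun x => x \notin F) p].

(** More than [f] neighbours in [U] leave one outside every forbidden [F]; entering and leaving [U]
    costs one edge at each end. *)
Lemma linked_grow1 D f U Z : linked D f U ->
  linked (D + 2) f (U :|: [set w in Z | f < deg G U w]).
Proof.
move=> lk F cF.
have near u : u \in U :|: [set w in Z | f < deg G U w] -> u \notin F ->
    exists u1, [/\ u1 \in U, u1 \notin F & (u == u1) || G u u1].
  rewrite !inE => /orP[uU uF|/andP[_ ud] uF]; first by exists u; rewrite eqxx.
  have : ~~ ([set y in U | G u y] \subset F).
    by apply/negP => /subset_leq_card; rewrite leqNgt (leq_ltn_trans cF ud).
  by case/subsetPn => u1; rewrite inE => /andP[u1U Gu] u1F; exists u1; rewrite Gu orbT.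
move=> u v uU vU uF vF.
have [u1 [u1U u1F Gu]] := near u uU uF; have [v1 [v1U v1F Gv]] := near v vU vF.
have [p [pp lp sp ap]] := lk F cF u1 v1 u1U v1U u1F v1F.
have [p' [pp' lp' sp' ap']] : exists p', [/\ path G u p', last u p' = v1,
    size p' <= D.+1 & all (fun x => x \notin F) p'].
  case: (eqVneq u u1) Gu => [-> _|_ /= Gu]; first by exists p; rewrite pp lp ap (leqW sp).
  by exists (u1 :: p); rewrite /= Gu pp lp u1F ap; split=> //.
case: (eqVneq v v1) Gv => [-> _|_ /= Gv].
  by exists p'; rewrite pp' lp' ap' addn2 (leqW sp').
exists (rcons p' v); rewrite rcons_path pp' lp' symG Gv last_rcons size_rcons.
by rewrite all_rcons vF ap' addn2 ltnS.
Qed.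

(** Every round that does not stop absorbs more than [f] vertices of [Z], so [n] bounds the number
    of rounds. *)
Lemma linked_grow f Z n D U : U \subset Z -> linked D f U -> #|Z :\: U| < n * f ->
  exists U', [/\ U \subset U', U' \subset Z, linked (D + 2 * n) f U' &
    #|[set w in Z :\: U' | f < deg G U' w]| <= f].
Proof.
elim: n D U => [|n IHn] D U UZ lk cU; first by rewrite mul0n in cU.
set N := [set w in Z :\: U | f < deg G U w].
have [le|lt] := leqP #|N| f.
  exists U; split=> // F cF u v uU vU uF vF.
  have [p [pp lp sp ap]] := lk F cF u v uU vU uF vF.
  by exists p; split=> //; apply: leq_trans sp (leq_addr _ _).
have NU : [disjoint U & N].
  rewrite -setI_eq0; apply/eqP/setP => x; rewrite !inE.
  by case: (x \in U).
have NZ : N \subset Z by apply/subsetP => x; rewrite !inE => /andP[/andP[]].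
have UNZ : U :|: N \subset Z by rewrite subUset UZ.
have lk' := linked_grow1 (Z := Z :\: U) lk.
have [|U' [sU U'Z lkU' few]] := IHn _ _ UNZ lk'.
  have -> : Z :\: (U :|: N) = (Z :\: U) :\: N by rewrite setDDl.
  have NZU : N \subset Z :\: U by apply/subsetP => x; rewrite inE => /andP[].
  have := cardsD (Z :\: U) N; rewrite (setIidPr NZU) => ->.
  by move: cU lt (subset_leq_card NZU); rewrite mulSn; clear; lia.
exists U'; split=> //; first exact: subset_trans (subsetUl _ _) sU.
by have -> : D + 2 * n.+1 = D + 2 + 2 * n by lia.
Qed.

(** A degree of [2 * t] leaves [t] neighbours outside [F]. For ends on opposite sides, regularity
    gives an edge between the two neighbourhoods. For ends on the same side, all but fewer than [t]
    vertices of that side see a given neighbourhood; two such exceptional sets and [F] cannot fill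
    [3 * t] vertices, so a common middle vertex exists. *)
Lemma hub_linked h t f A B : lower_reg G h t A B -> 0 < h -> 0 < t -> f <= t ->
  3 * t <= #|A| -> 3 * t <= #|B| ->
  linked 4 f ([set a in A | 2 * t <= deg G B a] :|: [set b in B | 2 * t <= deg G A b]).
Proof.
move=> reg h0 t0 ft tA tB F cF.
have regC := lower_regC symG reg.
pose Q T u := [set y in T :\: F | G u y].
have QT T u : Q T u \subset T by apply/subsetP => y; rewrite !inE => /andP[/andP[]].
have cQ T u : 2 * t <= deg G T u -> t <= #|Q T u|.
  move=> du; have := leq_trans du (deg_setD G T F u); rewrite /deg -/(Q T u).
  by move: cF ft; clear; lia.
have same A1 B1 u v : lower_reg G h t A1 B1 -> 3 * t <= #|A1| -> 3 * t <= #|B1| ->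
    2 * t <= deg G B1 u -> 2 * t <= deg G B1 v -> v \notin F ->
    exists p, [/\ path G u p, last u p = v, size p <= 4 & all (fun x => x \notin F) p].
  move=> reg1 tA1 tB1 du dv vF.
  have lowu w : 2 * t <= deg G B1 w -> #|[set a in A1 | deg G (Q B1 w) a < 1]| < t.
    move=> dw; rewrite ltnNge; apply/negP => tbad.
    set bad := [set a in A1 | _] in tbad.
    have badA : bad \subset A1 by apply/subsetP => x; rewrite inE => /andP[].
    have [x [y [xb yQ Gxy]]] := lower_reg_edge reg1 t0 badA (QT _ _) tbad (cQ _ _ dw).
    move: xb; rewrite inE => /andP[_]; rewrite ltnS leqn0 cards_eq0 => /eqP/setP/(_ y).
    by rewrite inE yQ Gxy inE.
  have : ~~ (A1 \subset F :|: [set a in A1 | deg G (Q B1 u) a < 1] :|: [set a in A1 | deg G (Q B1 v) a < 1]).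
    apply/negP => /subset_leq_card; move: (lowu u du) (lowu v dv).
    move: [set a in A1 | deg G (Q B1 u) a < 1] => X1.
    move: [set a in A1 | deg G (Q B1 v) a < 1] => X2.
    have := (leq_card_setU (F :|: X1) X2).1; have := (leq_card_setU F X1).1.
    by move: cF ft tA1; clear; lia.
  case/subsetPn => a aA1; rewrite !inE aA1 /= !negb_or => /andP[/andP[aF]].
  rewrite -!leqNgt => /card_gt0P[b]; rewrite !inE => /andP[/andP[/andP[bF bB] Gub] Gab].
  move=> /card_gt0P[b']; rewrite !inE => /andP[/andP[/andP[b'F b'B] Gvb'] Gab'].
  by exists [:: b; a; b'; v]; rewrite /= Gub symG Gab Gab' symG Gvb' bF aF b'F vF.
have cross A1 B1 u v : lower_reg G h t A1 B1 ->
    2 * t <= deg G B1 u -> 2 * t <= deg G A1 v -> v \notin F ->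
    exists p, [/\ path G u p, last u p = v, size p <= 4 & all (fun x => x \notin F) p].
  move=> reg1 du dv vF.
  have [a [b [aQ bQ Gab]]] :=
    lower_reg_edge reg1 t0 (QT _ _) (QT _ _) (cQ _ _ dv) (cQ _ _ du).
  move: aQ bQ; rewrite !inE => /andP[/andP[aF aA] Gva] /andP[/andP[bF bB] Gub].
  by exists [:: b; a; v]; rewrite /= Gub symG Gab symG Gva bF aF vF.
move=> u v; rewrite !inE => /orP[]/andP[uA du] /orP[]/andP[vA dv] uF vF.
- exact: (same A B).
- exact: (cross A B).
- exact: (cross B A).
- exact: (same B A).
Qed.

(* The target set [P] is kept aside until the last step, which makes the length exact. *)
Lemma alternating_path h t A B k A1 B1 P Q : lower_reg G h t A B ->
  0 < h -> 0 < t -> [disjoint A & B] -> A1 \subset A -> B1 \subset B ->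
  P \subset A -> Q \subset B1 -> [disjoint A1 & P] -> t <= #|Q| -> h * t <= #|P| ->
  h * t + k <= #|A1| -> h * t + k <= #|B1| ->
  exists q p z, [/\ q \in Q /\ z \in P, path G q (rcons p z), size p = 2 * k,
    uniq (q :: rcons p z) & {subset q :: p <= A1 :|: B1}].
Proof.
move=> reg h0 t0 dAB; have regC := lower_regC symG reg.
have th : t <= h * t by rewrite leq_pmull.
elim: k A1 B1 Q => [|k IHk] A1 B1 Q A1A B1B PA QB1 dA1P tQ tP tA1 tB1.
  have [z [q [zP qQ Gzq]]] := lower_reg_edge reg t0 PA (subset_trans QB1 B1B)
    (leq_trans th tP) tQ.
  exists q, [::], z; rewrite /= symG Gzq inE !andbT; split=> //.
    apply/eqP => qz; have /subsetP/(_ _ qQ) := subset_trans QB1 B1B.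
    by rewrite qz (disjointFr dAB) // (subsetP PA).
  by move=> x; rewrite !inE => /eqP ->; rewrite (subsetP QB1) // orbT.
(* The next vertex is left open within the set [Q] of at least [t] candidates. Choosing [q] with [t]
   neighbours in [A1], then [a] among these with [t] neighbours in [B1 :\ q], restores the invariant
   with the neighbours of [a] as new candidates. *)
have [|q qQ dq] := lower_reg_nbr regC h0 t0 (subset_trans QB1 B1B) A1A tQ.
  by apply: leq_trans tA1; rewrite leq_addr.
have qB1 : q \in B1 := subsetP QB1 _ qQ.
have cB1 : #|B1| = #|B1 :\ q|.+1 by rewrite (cardsD1 q) qB1.
set QA := [set a in A1 | G q a].
have QAA1 : QA \subset A1 by apply/subsetP => x; rewrite inE => /andP[].
have [|a aQA da] := lower_reg_nbr reg h0 t0 (subset_trans QAA1 A1A)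
   (subset_trans (subD1set B1 q) B1B) dq.
  by move: tB1; rewrite cB1; clear; lia.
move: (aQA); rewrite inE => /andP[aA1 Gqa].
have cA1 : #|A1| = #|A1 :\ a|.+1 by rewrite (cardsD1 a) aA1.
have [|||||||||q' [p [z [[q'Q zP] pp sp up sub]]]] :=
    IHk (A1 :\ a) (B1 :\ q) [set b in B1 :\ q | G a b].
- exact: subset_trans (subD1set _ _) A1A.
- exact: subset_trans (subD1set _ _) B1B.
- by [].
- by apply/subsetP => x; rewrite inE => /andP[].
- by apply: disjointWl dA1P; exact: subD1set.
- exact: da.
- by [].
- by move: tA1; rewrite cA1; clear; lia.
- by move: tB1; rewrite cB1; clear; lia.
have Gaq' : G a q' by move: q'Q; rewrite inE => /andP[].
have AB x : x \in A1 -> x \in B1 -> False.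
  by move=> /(subsetP A1A) xA /(subsetP B1B); rewrite (disjointFr dAB).
have PB x : x \in P -> x \in B1 -> False.
  by move=> /(subsetP PA) xA /(subsetP B1B); rewrite (disjointFr dAB).
exists q, (a :: q' :: p), z; split=> //=.
- by rewrite Gqa Gaq'.
- by rewrite sp; clear; lia.
- have aN x : x \in q' :: p -> x != a /\ x != q.
    move=> /sub; rewrite !inE => /orP[/andP[-> xA1]|/andP[-> xB1]]; split=> //.
      by apply/eqP => xq; apply: (AB x) => //; rewrite xq.
    by apply/eqP => xa; apply: (AB x) => //; rewrite xa.
  have za : z != a by apply/eqP => za; rewrite za (disjointFr dA1P) in zP.
  have zq : z != q by apply/eqP => zq; apply: (PB z) => //; rewrite zq.
  have notin x : (forall y, y \in q' :: p -> y != x) -> z != x -> x \notin q' :: rcons p z.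
    move=> h1 h2; rewrite -rcons_cons mem_rcons inE negb_or eq_sym h2 /=.
    by apply/negP => /h1; rewrite eqxx.
  rewrite -/(uniq (q' :: rcons p z)) up.
  rewrite -/(a \in q' :: rcons p z) (notin a)//; last by move=> y /aN[].
  rewrite in_cons negb_or (notin q)//; last by move=> y /aN[].
  by rewrite andbT; apply/andP; split=> //; apply/eqP => qa; apply: (AB q); rewrite // qa.
- move=> x; rewrite inE => /orP[/eqP ->|]; first by rewrite inE qB1 orbT.
  rewrite inE => /orP[/eqP ->|/sub]; first by rewrite inE aA1.
  by rewrite !inE => /orP[/andP[_ ->]|/andP[_ ->]]; rewrite ?orbT.
Qed.

(** [S] holds the vertices fixed in advance, such as ends and links; an obstacle [F] must miss them
    because the paths may pass through them. Lengths are counted in half the number of vertices. *)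
Definition flexible f (Reg S : {set V}) lo hi a b :=
  forall F, #|F| <= f -> [disjoint S & F] -> forall k, lo <= k <= hi ->
  exists p, [/\ path G a p /\ last a p = b, (size p).+1 = 2 * k, uniq (a :: p),
    {subset a :: p <= Reg} & [disjoint a :: p & F]].

(** The path consists of [a], a neighbour of [a], [2 * (k - 2)] alternating vertices, a vertex from
    a reserve of [h * t] neighbours of [b], and [b]. The term [5 * h ^ 2 * t] pays for the obstacle,
    the ends, the reserve and the [h * t] vertices that an alternating path cannot use up. *)
Lemma lower_reg_flexible h t f A B F : lower_reg G h t A B -> 0 < h -> 0 < t ->
  [disjoint A & B] -> #|A| = #|B| -> f <= t -> 5 * h ^ 2 * t < #|A| -> #|F| <= f ->
  exists a b, [/\ a \in A :\: F, b \in B :\: F &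
    flexible f (A :|: B) [set a; b] 2 (#|A| - 5 * h ^ 2 * t) a b].
Proof.
move=> reg h0 t0 dAB AB ft tA cF; have regC := lower_regC symG reg.
have th : t <= h * t by rewrite leq_pmull.
have hth : h * t <= h * (h * t) by rewrite leq_pmull.
have tA' : 5 * (h * (h * t)) < #|A|.
  by apply: leq_ltn_trans tA; rewrite expnS expn1; clear; lia.
have good A1 B1 : lower_reg G h t A1 B1 -> #|A1| = #|B1| -> #|A1| = #|A| ->
    exists2 a, a \in A1 :\: F & 5 * (h * t) <= deg G B1 a.
  move=> reg1 A1B1 A1A.
  have low : #|[set a in A1 | deg G B1 a < 5 * (h * t)]| < t.
    apply: few_low_deg reg1 t0 _ _.
  - by move: tA' th hth A1B1 A1A; clear; lia.
  - by move: tA' A1B1 A1A; clear; lia.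
  have : ~~ (A1 \subset F :|: [set a in A1 | deg G B1 a < 5 * (h * t)]).
    apply/negP => /subset_leq_card; move: low; move: [set a in A1 | _] => X.
    by have := (leq_card_setU F X).1; move: cF ft tA' th hth A1A; clear; lia.
  case/subsetPn => a aA1; rewrite !inE aA1 negb_or -leqNgt => /andP[aF da].
  by exists a; rewrite // inE aF.
have [a aA da] := good A B reg AB erefl.
have [b bB db] := good B A regC (esym AB) (esym AB).
exists a, b; split=> // F' cF' dF k /andP[k2 kA].
have aA' : a \in A by move: aA; rewrite inE => /andP[].
have bB' : b \in B by move: bB; rewrite inE => /andP[].
have aF' : a \notin F' by rewrite (disjointFr dF) // !inE eqxx.
have bF' : b \notin F' by rewrite (disjointFr dF) // !inE eqxx orbT.
pose X := F' :|: [set a; b].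
have cX : #|X| <= t + 2.
  by apply: leq_trans (leq_card_setU _ _) _; rewrite cards2; move: (a != b) cF' ft => e; clear; lia.
have [P0 PP cP] : exists2 P : {set V}, P \subset [set x in A :\: X | G b x] & #|P| = h * t.
  apply: subset_card.
  change (h * t <= deg G (A :\: X) b).
  by have := deg_setD G A X b; move: db cX th t0; clear; lia.
pose A1 := A :\: (X :|: P0); pose B1 := B :\: X.
have cXP : #|X :|: P0| <= t + 2 + h * t.
  by apply: leq_trans (leq_card_setU _ _) _; rewrite cP leq_add2r.
have cA1 : #|A| <= #|A1| + (t + 2 + h * t).
  by apply: leq_trans (card_setD_le A (X :|: P0)) _; rewrite leq_add2l.
have cB1 : #|B| <= #|B1| + (t + 2).
  by apply: leq_trans (card_setD_le B X) _; rewrite leq_add2l.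
have e2 : 5 * h ^ 2 * t = 5 * (h * (h * t)) by rewrite expnS expn1; clear; lia.
rewrite e2 in kA.
have [|||||||||q [p [z [[qQ zP] pp sp up sub]]]] := @alternating_path h t A B (k - 2)
   A1 B1 P0 [set x in B1 | G a x] reg h0 t0 dAB.
- exact: subsetDl.
- exact: subsetDl.
- by apply: subset_trans PP _; apply/subsetP => x; rewrite !inE => /andP[/andP[]].
- by apply/subsetP => x; rewrite inE => /andP[].
- by rewrite -setI_eq0; apply/eqP/setP => x; rewrite !inE; case: (x \in P0); rewrite ?andbF // orbT.
- change (t <= deg G (B :\: X) a).
  by have := deg_setD G B X a; move: da cX th t0; clear; lia.
- by rewrite cP.
- move: cA1 kA k2 th hth; clear; lia.
- move: cB1 kA k2 th hth AB; clear; lia.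
move: (subsetP PP _ zP); rewrite !inE => /andP[/andP[/norP[zF' /norP[za zb]] zA] Gbz].
move: qQ; rewrite !inE => /andP[/andP[/norP[qF' /norP[qa qb]] qB] Gaq].
have inX x : x \in q :: rcons p z -> x \in A :|: B /\ x \notin X.
  rewrite -rcons_cons mem_rcons in_cons => /orP[/eqP -> |/sub].
    by rewrite !inE zA; split=> //; apply/norP; split=> //; apply/norP.
  rewrite !inE negb_or => /orP[/andP[/andP[-> _] ->]|/andP[-> ->]] //.
  by rewrite orbT.
exists (q :: rcons (rcons p z) b); split.
- rewrite /= Gaq rcons_path last_rcons symG Gbz andbT pp; split=> //.
  by rewrite last_rcons.
- by rewrite /= !size_rcons sp; move: k2; clear; lia.
- rewrite -rcons_cons -rcons_cons rcons_uniq cons_uniq up andbT in_cons negb_or.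
  have nX y : y \in X -> y \notin q :: rcons p z by move=> yX; apply/negP => /inX[_]; rewrite yX.
  rewrite !nX ?andbT; last by rewrite !inE eqxx ?orbT.
    by apply/eqP => ba; move: aA'; rewrite -ba (disjointFl dAB).
  by rewrite !inE eqxx ?orbT.
- move=> x; rewrite -rcons_cons in_cons mem_rcons in_cons => /or3P[/eqP ->|/eqP ->|/inX[]//].
    by rewrite inE aA'.
  by rewrite inE bB' orbT.
- rewrite disjoint_subset; apply/subsetP => x; rewrite -rcons_cons in_cons mem_rcons in_cons.
  move=> /or3P[/eqP ->|/eqP ->|/inX[_]]; rewrite inE //.
  by rewrite inE negb_or => /andP[].
Qed.

End RegularPairs.

(** * Stringing blocks into a cycle *)

Section Chain.
Variables (V : finType) (G : rel V) (side : V -> bool).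
Hypothesis side_edge : forall x y, G x y -> side x != side y.
Variables (U : {set V}) (D f : nat).
Hypothesis lk : linked G D f U.
Implicit Types (F B S : {set V}) (bs : seq ({set V} * nat)).

Lemma side_path x p : path G x p -> side (last x p) = side x (+) odd (size p).
Proof.
elim: p x => [|y p IHp] x /=; first by rewrite addbF.
move=> /andP[/side_edge Gxy /IHp ->].
by case: (side x) (side y) Gxy => [] [] //; case: (odd _).
Qed.

(** Joining opposite sides makes the number of inner vertices even, so links and block paths can be
    added as half-lengths. *)
Lemma link_path F u v : #|F| <= f -> u \in U :\: F -> v \in U :\: F ->
  side u != side v ->
  exists l m, [/\ path G u (rcons l v), uniq (u :: rcons l v), size l = 2 * m,
    2 * m <= D & {in l, forall x, x \notin F}].
Proof.
move=> cF; rewrite !inE => /andP[uF uU] /andP[vF vU] uv.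
have [p0 [pp0 lp0 sp0 ap0]] := lk cF uU vU uF vF.
case: (shortenP pp0) lp0 => p pp up sub.
case/lastP: p pp up sub => [|l z] pp up sub; first by move=> /= e; rewrite e eqxx in uv.
rewrite last_rcons => e; subst z.
have odl : ~~ odd (size l).
  have := side_path pp; rewrite last_rcons size_rcons /=.
  by move: uv; case: (side u) (side v) (odd _) => [] [] [].
exists l, (size l)./2; rewrite mul2n even_halfK//; split=> //.
  have : size (rcons l v) <= size p0 by apply: uniq_leq_size; case/andP: up.
  by rewrite size_rcons => /ltnW/leq_trans; apply.
by move=> x xl; apply: (allP ap0); apply: sub; rewrite mem_rcons inE xl orbT.
Qed.

(** The ends are chosen after [F], so that a block can be attached to a chain whose links are
    already fixed. *)
Definition block f' B k := forall F, #|F| <= f' -> exists a b,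
  [/\ a \in (B :&: U) :\: F, b \in (B :&: U) :\: F, side a, ~~ side b &
      flexible G f' B [set a; b] 2 k a b].

Definition region bs := foldr (fun C R => C.1 :|: R) set0 bs.

Lemma disjoint_region B bs : all (fun C : {set V} * nat => [disjoint B & C.1]) bs ->
  [disjoint B & region bs].
Proof.
elim: bs => [|C bs IH] /=; first by rewrite disjoints_subset setC0 subsetT.
move=> /andP[BC /IH]; rewrite -!setI_eq0 setIUr in BC *.
by rewrite (eqP BC) set0U.
Qed.

Lemma card_seq_set (l : seq V) : #|[set x in l]| <= size l.
Proof. by rewrite cardsE card_size. Qed.

(** The half-length [k] is shared among a new block, a link with [2 * m] inner vertices and the rest
    of the chain: the rest gets its minimum if this suffices, otherwise the new block is used in
    full. *)
Lemma chain_arith n k m kap hi : 2 * m <= D -> D + 2 <= kap -> (D + 2) * n <= hi ->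
  (D + 2) * n.+1 <= k <= kap + hi ->
  exists k1 k2, [/\ 2 <= k1 <= kap, (D + 2) * n <= k2 <= hi & k1 + m + k2 = k].
Proof.
move=> mD Dk Dn; rewrite mulnS; move: ((D + 2) * n) Dn => x xhi.
move=> /andP[k1 k2]; have [le|lt] := leqP (k - m - kap) x.
  by exists (k - m - x), x; split; lia.
by exists kap, (k - m - kap); split; lia.
Qed.

(* The set [S] of link vertices is fixed before the long paths inside the blocks are
   built; these paths only have to avoid the bounded sets [S] and [F]. *)
Lemma chain (B0 : {set V} * nat) bs f1 F :
  (forall C, C \in B0 :: bs -> block f C.1 C.2) ->
  all (fun C : {set V} * nat => D + 2 <= C.2) (B0 :: bs) ->
  pairwise (fun C C' : {set V} * nat => [disjoint C.1 & C'.1]) (B0 :: bs) ->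
  f1 + #|F| + (D + 2) * size (B0 :: bs) <= f ->
  exists S a b, [/\ #|S| <= (D + 2) * size (B0 :: bs) /\ [disjoint S & F],
    a \in S :&: U /\ b \in S :&: U, side a, ~~ side b &
    flexible G f1 (S :|: region (B0 :: bs)) S ((D + 2) * size (B0 :: bs))
      (sumn (map snd (B0 :: bs))) a b].
Proof.
elim: bs B0 f1 F => [|C bs IH] B f1 F blk big dis szf.
  have cF : #|F| <= f by move: szf; clear; lia.
  have [a [b [aB bB sa sb flex]]] := blk B (mem_head _ _) F cF.
  move: aB bB; rewrite !inE => /andP[aF /andP[aB aU]] /andP[bF /andP[bB bU]].
  exists [set a; b], a, b; split=> //.
  - split; first by rewrite cards2 muln1; case: (a != b); rewrite /= ?addn2.
    rewrite disjoints_subset; apply/subsetP => x.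
    by rewrite !inE => /orP[] /eqP ->.
  - by rewrite !inE !eqxx orbT.
  move=> F' cF' dF' k /andP[k1 k2].
  have [||p [pp sp up sub dp]] := flex F' _ dF' k.
  - by move: cF' szf; clear; lia.
  - by move: k1 k2; rewrite /= muln1 addn0 => k1 ->; rewrite (leq_trans _ k1) ?leq_addl.
  by exists p; split=> // x /sub xB; rewrite !inE xB orbT.
have blk' C' : C' \in C :: bs -> block f C'.1 C'.2.
  by move=> CI; apply: blk; rewrite inE CI orbT.
have big' : all (fun C : {set V} * nat => D + 2 <= C.2) (C :: bs) by move: big => /= /andP[].
have dis' : pairwise (fun C C' : {set V} * nat => [disjoint C.1 & C'.1]) (C :: bs).
  by move: dis => /= /andP[].
set n := size (C :: bs) in szf *.
have szE : size (B :: C :: bs) = n.+1 by [].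
rewrite szE mulnS in szf.
(* The path through the tail must later also avoid the two new ends and the at most [D] inner
   vertices of the new link. *)
have [|S' [a' [b' [[cS' dS'F] [a'S b'S] sa' sb' flex']]]] := IH C (f1 + D + 2) F blk' big' dis'.
  by rewrite -/n; move: szf; clear; lia.
rewrite -/n in cS' flex'.
have cFS' : #|F :|: S'| <= f.
  by have := (leq_card_setU F S').1; move: szf cS'; clear; lia.
have [a [b [aB bB sa sb flex]]] := blk B (mem_head _ _) _ cFS'.
move: aB bB a'S b'S; rewrite !inE !negb_or.
move=> /andP[/andP[aF aS'] /andP[aB aU]] /andP[/andP[bF bS'] /andP[bB bU]].
move=> /andP[a'S' a'U] /andP[b'S' b'U].
have ba : b != a by apply: contraNneq sb => ->.
(* The link from [b] to [a'] avoids all fixed vertices except its own two ends. *)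
pose Fl := F :|: (a |: S' :\ a').
have cFl : #|Fl| <= f.
  have := (leq_card_setU F (a |: S' :\ a')).1; rewrite -/Fl.
  have := (leq_card_setU [set a] (S' :\ a')).1; rewrite cards1.
  have := subset_leq_card (subD1set S' a').
  by move: szf cS'; clear; lia.
have [|||l [m [pl ul sl mD lF]]] := @link_path Fl b a' cFl.
- by rewrite !inE (negbTE bF) (negbTE ba) (negbTE bS') andbF bU.
- rewrite !inE eqxx a'U (disjointFr dS'F a'S') /= orbF andbT.
  by apply: contraNneq aS' => <-.
- by rewrite sa' (negbTE sb).
have a'l : a' \notin l by move: ul; rewrite /= rcons_uniq => /and3P[].
have bl : b \notin l.
  by move: ul; rewrite /= mem_rcons inE negb_or => /andP[/andP[]].
have ul' : uniq l by move: ul; rewrite /= rcons_uniq => /and3P[].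
have al : a \notin l by apply/negP => /lF; rewrite !inE eqxx !orbT.
have lS' x : x \in l -> x \notin S'.
  move=> xl; apply/negP => xS'; have := lF x xl; rewrite !inE xS' andbT.
  by rewrite (memPn a'l x xl) !orbT.
have lNF x : x \in l -> x \notin F by move=> /lF; rewrite inE negb_or => /andP[].
pose S := [set a; b] :|: (S' :|: [set x in l]).
have cS : #|S| <= (D + 2) * n.+1.
  have := (leq_card_setU [set a; b] (S' :|: [set x in l])).1; rewrite -/S.
  have := (leq_card_setU S' [set x in l]).1; have := card_seq_set l.
  have : #|[set a; b]| <= 2 by rewrite cards2; case: (a != b).
  rewrite sl mulnS; move: cS' mD; clear; lia.
exists S, a, b'; split=> //.
- split=> //; rewrite disjoints_subset; apply/subsetP => x.
  rewrite !inE => /or3P[/orP[] /eqP -> //|xS'|/lNF //].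
  by rewrite (disjointFr dS'F xS').
- by rewrite !inE eqxx aU b'S' b'U !orbT.
move=> F' cF' dF' k krange.
have Fout x : x \in S -> x \notin F' by move=> xS; rewrite (disjointFr dF' xS).
have lohi : (D + 2) * n <= sumn (map snd (C :: bs)).
  rewrite /n; elim: (C :: bs) big' => [_|C' bs' IH' /=]; first by rewrite /= muln0.
  by move=> /andP[hC' /IH' h]; rewrite mulnS leq_add.
have D2B : D + 2 <= B.2 by move: big => /= /andP[].
have [k1 [k2 [k1r k2r kE]]] := chain_arith mD D2B lohi krange.
have cl : #|[set x in l]| <= D.
  by apply: leq_trans (card_seq_set _) _; rewrite sl.
pose F1 := F' :|: (S' :|: [set x in l]).
have [||p1 [[pp1 lp1] sp1 up1 sub1 dp1]] := flex F1 _ _ k1 k1r.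
- have := (leq_card_setU F' (S' :|: [set x in l])).1; rewrite -/F1.
  have := (leq_card_setU S' [set x in l]).1.
  by move: cF' cS' cl szf; clear; lia.
- rewrite disjoints_subset; apply/subsetP => x.
  rewrite !inE !negb_or => /orP[]/eqP ->.
    by rewrite aS' al andbT (Fout a)// !inE eqxx.
  by rewrite bS' bl andbT (Fout b)// !inE eqxx orbT.
pose F2 := F' :|: ([set a; b] :|: [set x in l]).
have [||p2 [[pp2 lp2] sp2 up2 sub2 dp2]] := flex' F2 _ _ k2 k2r.
- have := (leq_card_setU F' ([set a; b] :|: [set x in l])).1; rewrite -/F2.
  have := (leq_card_setU [set a; b] [set x in l]).1.
  have : #|[set a; b]| <= 2 by rewrite cards2; case: (a != b).
  by move: cF' cl; clear; lia.
- rewrite disjoints_subset; apply/subsetP => x xS'.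
  rewrite !inE !negb_or (Fout x) ?inE ?xS' ?orbT //=.
  apply/andP; split; last by apply/negP => /lS'; rewrite xS'.
  by apply/andP; split; apply: contraTneq xS' => ->.
have in1 x : x \in a :: p1 -> [/\ x \in B.1, x \notin F', x \notin S' & x \notin l].
  move=> xp; have := disjointFr dp1 xp; rewrite !inE => /norP[? /norP[]].
  by split=> //; exact: sub1.
have in2 x : x \in a' :: p2 ->
   [/\ x \in S' :|: region (C :: bs), x \notin F' & x \notin l].
  move=> xp; have := disjointFr dp2 xp; rewrite !inE => /norP[? /norP[]].
  by split=> //; have := sub2 x xp; rewrite !inE.
have dBr : [disjoint B.1 & region (C :: bs)].
  by apply: disjoint_region; move: dis => /= /andP[].
exists (p1 ++ rcons l a' ++ p2); split.
- split; last by rewrite !last_cat last_rcons lp2.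
  by rewrite !cat_path pp1 lp1 pl last_rcons pp2.
- rewrite !size_cat size_rcons sl; move: kE sp1 sp2; clear; lia.
- rewrite -cat_cons cat_uniq up1 cat_rcons cat_uniq ul' up2 andbT andTb.
  apply/andP; split; last first.
    by rewrite -all_predC; apply/allP => x xp /=; case: (in2 x xp).
  rewrite -all_predC; apply/allP => x; rewrite mem_cat => /orP[xl|xp] /=.
    by apply/negP => /in1[_ _ _]; rewrite xl.
  apply/negP => /in1[xB _ xS' _]; have [+ _ _] := in2 x xp.
  by rewrite inE (negbTE xS') /= (disjointFr dBr xB).
- move=> x; rewrite -cat_cons cat_rcons !mem_cat => /or3P[/in1[xB _ _ _]|xl|/in2[+ _ _]].
  + by rewrite !inE xB !orbT.
  + by rewrite !inE xl !orbT.
  + by rewrite !inE => /or3P[->|->|->]; rewrite !orbT.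
- rewrite disjoint_subset; apply/subsetP => x.
  rewrite -cat_cons cat_rcons !mem_cat inE => /or3P[/in1[]//|xl|/in2[]//].
  by apply: Fout; rewrite !inE xl !orbT.
Qed.

(** A last link closes the chain. It is chosen before the long path, which avoids its inner vertices
    and supplies the remaining half-length [k - m]. *)
Lemma cycle_of_blocks (B0 : {set V} * nat) bs k :
  (forall C, C \in B0 :: bs -> block f C.1 C.2) ->
  all (fun C : {set V} * nat => D + 2 <= C.2) (B0 :: bs) ->
  pairwise (fun C C' : {set V} * nat => [disjoint C.1 & C'.1]) (B0 :: bs) ->
  D + (D + 2) * size (B0 :: bs) <= f ->
  D + (D + 2) * size (B0 :: bs) <= k <= sumn (map snd (B0 :: bs)) ->
  exists c, [/\ cycle G c, uniq c & size c = 2 * k].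
Proof.
move=> blk big dis szf /andP[klo khi].
have [|S [a [b [[cS _] [aS bS] sa sb flex]]]] :=
  @chain B0 bs D set0 blk big dis; first by rewrite cards0 addn0.
move: aS bS; rewrite !inE => /andP[aS aU] /andP[bS bU].
pose Fl := S :\: [set a; b].
have [||||l [m [pl ul sl mD lF]]] := @link_path Fl b a.
- apply: leq_trans (subset_leq_card (subsetDl _ _)) _.
  by move: cS szf; clear; lia.
- by rewrite !inE bU eqxx orbT.
- by rewrite !inE aU eqxx.
- by rewrite sa (negbTE sb).
have ul' : uniq l by move: ul; rewrite /= rcons_uniq => /and3P[].
have al : a \notin l by move: ul; rewrite /= rcons_uniq => /and3P[].
have bl : b \notin l.
  by move: ul; rewrite /= mem_rcons inE negb_or => /andP[/andP[]].
have [|||p [[pp lp] sp up _ dp]] := flex [set x in l] _ _ (k - m).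
- by apply: leq_trans (card_seq_set _) _; rewrite sl.
- rewrite disjoint_sym disjoints_subset; apply/subsetP => x; rewrite !inE => xl.
  have := lF x xl; rewrite !inE negb_and negbK => /orP[/orP[]/eqP e|//].
    by rewrite -e xl in al.
  by rewrite -e xl in bl.
- by move: klo khi mD; clear; lia.
exists (a :: p ++ l); split.
- by rewrite /= rcons_cat cat_path pp lp.
- rewrite -cat_cons cat_uniq up ul' andbT -all_predC; apply/allP => x xl /=.
  by apply/negP => xp; have := disjointFr dp xp; rewrite inE xl.
- by rewrite /= size_cat sl; move: sp klo mD; clear; lia.
Qed.

End Chain.

(** * Packings of lower regular pairs *)

Lemma ex_max_nat (P : nat -> Prop) b : (exists n, P n) -> (forall n, P n -> n <= b) ->
  exists n, P n /\ forall n', P n' -> n' <= n.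
Proof.
move=> [n0 Pn0] bd.
have ex : exists n, `[< P n >] by exists n0; apply/asboolP.
have ub n : `[< P n >] -> n <= b by move=> /asboolP/bd.
case: (ex_maxnP ex ub) => n /asboolP Pn max; exists n; split=> // n' Pn'.
by apply: max; apply/asboolP.
Qed.

Lemma bijection_of_card (V : finType) (A B : {set V}) : #|A| = #|B| ->
  exists P : {set V * V}, [/\ fst @: P = A, snd @: P = B, {in P &, injective fst},
    {in P &, injective snd} & #|P| = #|A|].
Proof.
move=> AB; pose P := [set (enum_val i, enum_val (cast_ord AB i)) | i : 'I_#|A|].
have PP e : e \in P -> exists i, e = (enum_val i, enum_val (cast_ord AB i)).
  by move=> /imsetP[i _ ->]; exists i.
exists P; split.
- apply/setP => x; apply/imsetP/idP => [[e /PP[i ->] ->]|xA] /=; first exact: enum_valP.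
  exists (x, enum_val (cast_ord AB (enum_rank_in xA x))) => //.
  by apply/imsetP; exists (enum_rank_in xA x); rewrite ?enum_rankK_in.
- apply/setP => y; apply/imsetP/idP => [[e /PP[i ->] ->]|yB] /=; first exact: enum_valP.
  exists (enum_val (cast_ord (esym AB) (enum_rank_in yB y)), y) => //.
  apply/imsetP; exists (cast_ord (esym AB) (enum_rank_in yB y)) => //.
  by rewrite cast_ordKV enum_rankK_in.
- by move=> _ _ /PP[i ->] /PP[j ->] /= /enum_val_inj ->.
- by move=> _ _ /PP[i ->] /PP[j ->] /= /enum_val_inj/cast_ord_inj ->.
- by rewrite card_imset ?card_ord // => i j [/enum_val_inj].
Qed.

Section Packing.
Variables (V : finType) (G : rel V).
Hypothesis symG : symmetric G.
Variables (X Y : {set V}) (h m : nat).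
Implicit Types (E P : {set V * V}) (lab : V * V -> nat) (thr : nat -> nat).

Definition label_class E lab t := [set e in E | lab e == t].

(* [E] is a set of matched pairs of vertices, not of edges of [G]; the pairs carrying the
   same label span a lower regular pair. *)
Definition packing E lab thr K :=
  [/\ E \subset setX X Y, {in E &, injective fst}, {in E &, injective snd},
    {in E, forall e, lab e < K} &
    forall t, t < K -> m <= thr t /\
      lower_reg G h (thr t) (fst @: label_class E lab t) (snd @: label_class E lab t)].

Lemma packing0 : packing set0 (fun=> 0) (fun=> 0) 0.
Proof. by split=> //; [exact: sub0set|move=> e e'|move=> e e'|move=> e]; rewrite inE. Qed.

(** This is where absolute thresholds pay off: a class that loses pairs to an augmentation keeps its
    threshold. *)
Lemma packing_sub E E' lab thr K : E' \subset E -> packing E lab thr K ->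
  packing E' lab thr K.
Proof.
move=> sE [EXY inj1 inj2 labK reg]; have /subsetP sE' := sE; split.
- exact: subset_trans EXY.
- by move=> e e' /sE' eE /sE'; exact: inj1.
- by move=> e e' /sE' eE /sE'; exact: inj2.
- by move=> e /sE'; exact: labK.
move=> t tK; have [mt regt] := reg t tK; split=> //.
have sc : label_class E' lab t \subset label_class E lab t.
  by apply/subsetP => e; rewrite !inE => /andP[/sE' -> ->].
by apply: lower_reg_sub (leqnn _) _ _ regt; exact: imsetS.
Qed.

Lemma packing_add E lab thr K (A B : {set V}) t0 : packing E lab thr K ->
  A \subset X :\: fst @: E -> B \subset Y :\: snd @: E -> #|A| = #|B| ->
  lower_reg G h t0 A B -> m <= t0 ->
  exists E' lab' thr', [/\ packing E' lab' thr' K.+1,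
    fst @: E' = fst @: E :|: A, snd @: E' = snd @: E :|: B,
    #|E'| = #|E| + #|A| & \sum_(t < K.+1) thr' t = \sum_(t < K) thr t + t0].
Proof.
move=> [EXY inj1 inj2 labK reg] AX BY AB regAB mt0.
have [P [P1 P2 injP1 injP2 cP]] := bijection_of_card AB.
have PA e : e \in P -> e.1 \in A by move=> eP; rewrite -P1 imset_f.
have PB e : e \in P -> e.2 \in B by move=> eP; rewrite -P2 imset_f.
have PNE1 e e' : e \in P -> e' \in E -> e.1 <> e'.1.
  move=> /PA/(subsetP AX); rewrite inE => /andP[/negP h1 _] e'E ee.
  by apply: h1; rewrite ee imset_f.
have PNE2 e e' : e \in P -> e' \in E -> e.2 <> e'.2.
  move=> /PB/(subsetP BY); rewrite inE => /andP[/negP h1 _] e'E ee.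
  by apply: h1; rewrite ee imset_f.
have EP e : e \in E -> e \in P = false.
  by move=> eE; apply/negP => eP; apply: (PNE1 e e).
pose lab' e := if e \in P then K else lab e.
pose thr' t := if t == K then t0 else thr t.
exists (E :|: P), lab', thr'; split.
- split.
  + rewrite subUset EXY; apply/subsetP => -[x y] eP; rewrite inE /=.
    have /(subsetP AX) := PA _ eP; rewrite inE => /andP[_ ->].
    by have /(subsetP BY) := PB _ eP; rewrite inE => /andP[_ ->].
  + move=> e e'; rewrite !inE => /orP[eE|eP] /orP[eE'|eP'] ee.
    * exact: inj1.
    * by case: (PNE1 e' e).
    * by case: (PNE1 e e').
    * exact: injP1.
  + move=> e e'; rewrite !inE => /orP[eE|eP] /orP[eE'|eP'] ee.
    * exact: inj2.
    * by case: (PNE2 e' e).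
    * by case: (PNE2 e e').
    * exact: injP2.
  + move=> e; rewrite inE /lab' => eEP; case: (boolP (e \in P)) eEP => [_ _|eP].
      exact: ltnSn.
    by rewrite orbF => /labK; exact: leqW.
  move=> t; rewrite ltnS leq_eqVlt /thr' => /orP[/eqP ->|tK].
    rewrite eqxx; split=> //.
    have -> : label_class (E :|: P) lab' K = P.
      apply/setP => e; rewrite !inE /lab'; case: (boolP (e \in P)) => [_|_].
        by rewrite eqxx orbT.
      by apply/negbTE/negP => /andP[/orP[/labK lt /eqP eK|//]]; rewrite eK ltnn in lt.
    by rewrite P1 P2.
  have tK' : (t == K) = false by apply/negbTE; rewrite neq_ltn tK.
  rewrite tK'.
  have -> : label_class (E :|: P) lab' t = label_class E lab t; last exact: reg.
  apply/setP => e; rewrite !inE /lab'; case: (boolP (e \in P)) => [eP|_].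
    rewrite eq_sym tK' andbF; apply/esym/negP => /andP[eE _].
    by rewrite EP in eP.
  by rewrite orbF.
- by rewrite imsetU P1.
- by rewrite imsetU P2.
- rewrite -cP cardsU; suff -> : E :&: P = set0 by rewrite cards0 subn0.
  by apply/setP => e; rewrite !inE; case: (boolP (e \in E)) => //= /EP ->.
rewrite big_ord_recr /= /thr' eqxx; congr (_ + _).
by apply: eq_bigr => i _; rewrite (ltn_eqF (ltn_ord i)).
Qed.

End Packing.

Section MaxPacking.
Variables (V : finType) (G : rel V).
Hypothesis symG : symmetric G.
Variables (X Y : {set V}) (h m q N : nat).
Hypotheses (h0 : 0 < h) (q1 : 1 < q) (m0 : 0 < m) (N0 : 0 < N).
Hypotheses (XN : #|X| <= N) (YN : #|Y| <= N).
Let Q := q ^ (2 * h * q ^ 2).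
Hypothesis mN : h * (m * Q ^ (2 * h * Q ^ 2)) <= N.

(* Matched pairs [(a, b)] that can be replaced by two pairs [(x, b)] and [(a, y)]. *)
Definition rich h N X' Y' (E : {set V * V}) := [set e in E |
  (N <= h * deg G X' e.2) && (N <= h * deg G Y' e.1)].

Let Q1 : 1 < Q.
Proof.
rewrite /Q -{1}(expn0 q) ltn_exp2l //.
by rewrite muln_gt0 expn_gt0 (ltnW q1) muln_gt0 h0.
Qed.

Let qQ : q <= Q.
Proof.
rewrite /Q -{1}(expn1 q) leq_exp2l //.
by rewrite muln_gt0 expn_gt0 (ltnW q1) muln_gt0 h0.
Qed.

Lemma edges_ge_deg (S T : {set V}) :
  {in S, forall x, N <= h * deg G T x} -> #|S| * N <= h * edges G S T.
Proof.
by move=> dS; rewrite -sum_nat_const /edges big_distrr leq_sum.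
Qed.

Lemma packing_add_unmatched E lab thr K : packing G X Y (2 * h) m E lab thr K ->
  q * \sum_(t < K) thr t <= 2 * #|E| ->
  N ^ 2 <= h * edges G (X :\: fst @: E) (Y :\: snd @: E) ->
  exists E' lab' thr' K', [/\ packing G X Y (2 * h) m E' lab' thr' K',
    q * \sum_(t < K') thr' t <= 2 * #|E'| & #|E| < #|E'|].
Proof.
move=> pE sumE; set X' := X :\: _; set Y' := Y :\: _ => dense.
have X'N : #|X'| <= N by apply: leq_trans XN; rewrite subset_leq_card ?subsetDl.
have Y'N : #|Y'| <= N by apply: leq_trans YN; rewrite subset_leq_card ?subsetDl.
(* Density on the scale of [N ^ 2] forces both sides to have at least [N / h] vertices, enough for
   the search with ratio [Q]. *)
have big a b : a <= N -> b <= N -> N ^ 2 <= h * (a * b) -> m * Q ^ (2 * h * Q ^ 2) <= a.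
  move=> aN bN; rewrite -mulnn => le; rewrite -(leq_pmul2l h0).
  apply: leq_trans mN _; rewrite -(leq_pmul2r N0); apply: leq_trans le _.
  by rewrite mulnA leq_mul.
have dXY := leq_trans dense (leq_mul (leqnn h) (edges_le G X' Y')).
have bX := big _ _ X'N Y'N dXY.
have bY : m * Q ^ (2 * h * Q ^ 2) <= #|Y'| by apply: big Y'N X'N _; rewrite (mulnC #|Y'|).
have [|i iJ [A [B [AX BY cA cB reg]]]] := lower_reg_subpair symG h0 Q1 m0 bX bY.
  by apply: leq_trans dense; rewrite -mulnn leq_mul.
have mi : m <= m * Q ^ i by rewrite leq_pmulr // expn_gt0 (ltnW Q1).
have [|E' [lab' [thr' [pE' _ _ cE' sE']]]] := packing_add pE AX BY _ reg mi.
  by rewrite cA cB.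
exists E', lab', thr', K.+1; split=> //.
  rewrite cE' sE' !mulnDr leq_add // cA expnS.
  have -> : m * (Q * Q ^ i) = Q * (m * Q ^ i) by rewrite mulnCA.
  by apply: leq_trans (leq_pmull _ _); rewrite // leq_mul2r qQ orbT.
by rewrite cE' -[X in X < _]addn0 ltn_add2l cA muln_gt0 m0 expn_gt0 (ltnW Q1).
Qed.

(* A regular pair is found first between [X'] and the rich [b]'s, then, inside the matched
   [a]'s, a second one with [Y']. The first search uses the ratio [Q = q ^ (2 h q^2)], so
   that its threshold is at most that of the second one. The invariant
   [q * \sum thr <= 2 * #|E|] bounds the total loss at the thresholds although augmentation
   shrinks old classes: two new classes of equal size [x] are created when [#|E|] grows by [x]. *)
Lemma packing_augment E lab thr K : packing G X Y (2 * h) m E lab thr K ->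
  q * \sum_(t < K) thr t <= 2 * #|E| ->
  N <= h * #|rich h N (X :\: fst @: E) (Y :\: snd @: E) E| ->
  exists E' lab' thr' K', [/\ packing G X Y (2 * h) m E' lab' thr' K',
    q * \sum_(t < K') thr' t <= 2 * #|E'| & #|E| < #|E'|].
Proof.
move=> pE sumE; set X' := X :\: _; set Y' := Y :\: _; set R := rich _ _ _ _ _ => bigR.
have [EXY inj1 inj2 _ _] := pE.
have RE e : e \in R -> e \in E by rewrite inE => /andP[].
have injR1 : {in R &, injective fst} by move=> e e' /RE eE /RE; exact: inj1.
have injR2 : {in R &, injective snd} by move=> e e' /RE eE /RE; exact: inj2.
have X'N : #|X'| <= N by apply: leq_trans XN; rewrite subset_leq_card ?subsetDl.
have Y'N : #|Y'| <= N by apply: leq_trans YN; rewrite subset_leq_card ?subsetDl.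
set L := m * Q ^ (2 * h * Q ^ 2); have hL : h * L <= N := mN.
have bR : L <= #|R| by rewrite -(leq_pmul2l h0) (leq_trans hL).
have L0 : 0 < L by rewrite muln_gt0 m0 expn_gt0 (ltnW Q1).
have /card_gt0P[e0 e0R] := leq_trans L0 bR.
have bX : L <= #|X'|.
  rewrite -(leq_pmul2l h0); apply: leq_trans hL _; move: e0R.
  rewrite inE => /and3P[_ d1 _]; apply: leq_trans d1 _.
  by rewrite leq_mul2l deg_le orbT.
have bY : L <= #|Y'|.
  rewrite -(leq_pmul2l h0); apply: leq_trans hL _; move: e0R.
  rewrite inE => /and3P[_ _ d1]; apply: leq_trans d1 _.
  by rewrite leq_mul2l deg_le orbT.
set B := snd @: R; have cB : #|B| = #|R| by rewrite card_in_imset.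
have [||i iJ [X1 [B1 [X1X B1B cX1 cB1 reg1]]]] := lower_reg_subpair symG (T := B) h0 Q1 m0 bX.
- by rewrite cB.
- rewrite mulnC edgesC //; apply: leq_trans (edges_ge_deg _).
    by rewrite leq_mul.
  by move=> y /imsetP[e]; rewrite inE => /and3P[_ d1 _] ->.
set t1 := m * Q ^ i in reg1.
have t10 : 0 < t1 by rewrite muln_gt0 m0 expn_gt0 (ltnW Q1).
have s1E : m * Q ^ i.+1 = t1 * Q by rewrite expnSr mulnA.
rewrite s1E in cX1 cB1.
pose R1 := [set e in R | e.2 \in B1].
have R1R e : e \in R1 -> e \in R by rewrite inE => /andP[].
have R1B1 : snd @: R1 = B1.
  apply/setP => y; apply/imsetP/idP => [[e]|yB1]; first by rewrite inE => /andP[_ eB1] ->.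
  by have /imsetP[e eR ye] := subsetP B1B _ yB1; exists e; rewrite // inE eR -ye.
have cR1 : #|R1| = t1 * Q.
  by rewrite -cB1 -R1B1 card_in_imset // => e e' /R1R eR /R1R; exact: injR2.
set A1 := fst @: R1.
have cA1 : #|A1| = t1 * Q.
  by rewrite card_in_imset // => e e' /R1R eR /R1R; exact: injR1.
have [|||j jJ [A2 [Y2 [A2A Y2Y cA2 cY2 reg2]]]] :=
    lower_reg_subpair symG (S := A1) (T := Y') h0 q1 t10.
- by rewrite cA1.
- by apply: leq_trans bY; rewrite -/Q -s1E leq_mul2l leq_exp2l // iJ orbT.
- apply: leq_trans (edges_ge_deg _); first by rewrite leq_mul.
  by move=> y /imsetP[e /R1R]; rewrite inE => /and3P[_ _ d1] ->.
set t2 := t1 * q ^ j in reg2.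
have s2E : t1 * q ^ j.+1 = q * t2 by rewrite expnS mulnCA.
rewrite s2E in cA2 cY2.
have t12 : t1 <= t2 by rewrite leq_pmulr // expn_gt0 (ltnW q1).
have t20 : 0 < t2 := leq_trans t10 t12.
pose R2 := [set e in R1 | e.1 \in A2].
have R2E e : e \in R2 -> e \in E by rewrite inE => /andP[/R1R/RE].
have R2A2 : fst @: R2 = A2.
  apply/setP => y; apply/imsetP/idP => [[e]|yA2]; first by rewrite inE => /andP[_ eA2] ->.
  by have /imsetP[e eR ye] := subsetP A2A _ yA2; exists e; rewrite // inE eR -ye.
have cR2 : #|R2| = q * t2.
  by rewrite -cA2 -R2A2 card_in_imset // => e e' /R2E eR /R2E; exact: inj1.
set B2 := snd @: R2.
have cB2 : #|B2| = q * t2.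
  by rewrite card_in_imset // => e e' /R2E eR /R2E; exact: inj2.
have B2B1 : B2 \subset B1.
  by apply/subsetP => y /imsetP[e]; rewrite !inE => /andP[/andP[_ +] _] ->.
have [X2 X2X1 cX2] : exists2 X2 : {set V}, X2 \subset X1 & #|X2| = q * t2.
  by apply: subset_card; rewrite cX1 -s2E leq_mul2l leq_exp2l // jJ orbT.
have reg3 : lower_reg G (2 * h) t2 X2 B2 by exact: lower_reg_sub t12 X2X1 B2B1 reg1.
have mt2 : m <= t2.
  by apply: leq_trans t12; rewrite leq_pmulr // expn_gt0 (ltnW Q1).
have pE0 := packing_sub (subsetDl E R2) pE.
have cE0 : #|E :\: R2| = #|E| - q * t2.
  rewrite cardsD -cR2; congr (_ - _); apply: eq_card => e; rewrite inE.
  by case: (boolP (e \in R2)) => [/R2E ->|_]; rewrite ?andbF.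
have cR2E : q * t2 <= #|E|.
  by rewrite -cR2 subset_leq_card //; apply/subsetP.
have X2X' : X2 \subset X' by exact: subset_trans X2X1 X1X.
(* The pairs of [R2] leave the packing and their ends return in two new classes: [B2] matched with
   [X2], then [A2] matched with [Y2]. *)
have [|||E1 [lab1 [thr1 [pE1 E11 E12 cE1 sE1]]]] := packing_add pE0 _ _ _ reg3 mt2.
- apply: subset_trans X2X' _; apply: setDS; apply: imsetS; exact: subsetDl.
- apply/subsetP => y /imsetP[e eR2 ->]; rewrite inE; apply/andP; split.
    apply/negP => /imsetP[e' /setDP[e'E e'R2] ee].
    by rewrite -(inj2 _ _ (R2E _ eR2) e'E ee) eR2 in e'R2.
  by have := subsetP EXY _ (R2E _ eR2); rewrite inE => /andP[].
- by rewrite cX2 cB2.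
have [|||E2 [lab2 [thr2 [pE2 E21 E22 cE2 sE2]]]] := packing_add pE1 _ _ _ reg2 mt2.
- rewrite -R2A2; apply/subsetP => y /imsetP[e eR2 ->]; rewrite inE E11; apply/andP; split.
    rewrite inE; apply/norP; split.
      apply/negP => /imsetP[e' /setDP[e'E e'R2] ee].
      by rewrite -(inj1 _ _ (R2E _ eR2) e'E ee) eR2 in e'R2.
    apply/negP => /(subsetP X2X'); rewrite inE => /andP[/negP + _]; apply.
    by rewrite imset_f // R2E.
  by have := subsetP EXY _ (R2E _ eR2); rewrite inE => /andP[].
- apply/subsetP => y /(subsetP Y2Y); rewrite !inE => /andP[yE ->].
  rewrite andbT E12 inE; apply/norP; split; apply: contra yE.
    by apply: subsetP; apply: imsetS; exact: subsetDl.
  by move=> /imsetP[e /R2E eE ->]; rewrite imset_f.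
- by rewrite cA2 cY2.
have cE2' : #|E2| = #|E| + q * t2.
  by rewrite cE2 cE1 cE0 cX2 cA2 subnK.
exists E2, lab2, thr2, K.+2; split=> //.
  rewrite sE2 sE1 cE2' !mulnDr; move: sumE; clear; lia.
by rewrite cE2' -[X in X < _]addn0 ltn_add2l muln_gt0 t20 (ltnW q1).
Qed.

Lemma max_packing : exists E lab thr K,
  [/\ packing G X Y (2 * h) m E lab thr K,
    q * \sum_(t < K) thr t <= 2 * #|E|,
    h * edges G (X :\: fst @: E) (Y :\: snd @: E) < N ^ 2 &
    h * #|rich h N (X :\: fst @: E) (Y :\: snd @: E) E| < N].
Proof.
pose P n := exists E lab thr K, [/\ packing G X Y (2 * h) m E lab thr K,
  q * \sum_(t < K) thr t <= 2 * #|E| & #|E| = n].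
have [||n [[E [lab [thr [K [pE sE cE]]]]] max]] := @ex_max_nat P #|{: V * V}|.
- exists 0, set0, (fun=> 0), (fun=> 0), 0; split; first exact: packing0.
    by rewrite big_ord0 muln0.
  by rewrite cards0.
- by move=> n [E [_ [_ [_ [_ _ <-]]]]]; exact: max_card.
exists E, lab, thr, K; split=> //; rewrite ltnNge; apply/negP => bad.
  have [E' [lab' [thr' [K' [pE' sE' ]]]]] := packing_add_unmatched pE sE bad.
  by rewrite cE ltnNge => /negP; apply; apply: max; exists E', lab', thr', K'.
have [E' [lab' [thr' [K' [pE' sE' ]]]]] := packing_augment pE sE bad.
by rewrite cE ltnNge => /negP; apply; apply: max; exists E', lab', thr', K'.
Qed.

End MaxPacking.

(** * Cycles from packings, and robustly connected sets *)

Lemma divn_bounds N d k : 0 < d -> 0 < k -> d * k <= N ->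
  [/\ d * (N %/ d) <= N, k <= N %/ d & N <= 2 * d * (N %/ d)].
Proof.
move=> d0 k0 dk; have le : k <= N %/ d by rewrite leq_divRL // mulnC.
rewrite mulnC leq_trunc_div le; split=> //.
have := ltn_ceil N d0; rewrite mulSn; set x := N %/ d in le *.
have : d <= d * x by rewrite leq_pmulr // (leq_trans k0).
rewrite (mulnC x) -mulnA; clear; lia.
Qed.

Lemma sub_lt_bound a y d t : a - y < d -> d <= t -> a <= 0 + (t + y).
Proof. lia. Qed.

Lemma few_low_arith m t x a b : m <= t -> 8 * t <= x -> b < t -> x <= a + b -> m <= a.
Proof. lia. Qed.

Lemma card_class_sum (V : finType) (E : {set V * V}) (lab : V * V -> nat) K :
  {in E, forall e, lab e < K} -> #|E| <= \sum_(t < K) #|label_class E lab t|.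
Proof.
move=> labK; suff le k : #|[set e in E | lab e < k]| <= \sum_(t < k) #|label_class E lab t|.
  apply: leq_trans (le K); apply: subset_leq_card; apply/subsetP => e eE.
  by rewrite inE eE labK.
elim: k => [|k IHk].
  by rewrite big_ord0 leqn0 cards_eq0; apply/eqP/setP => e; rewrite !inE ltn0 andbF.
rewrite big_ord_recr /=.
have -> : [set e in E | lab e < k.+1] = [set e in E | lab e < k] :|: label_class E lab k.
  by apply/setP => e; rewrite !inE ltnS leq_eqVlt andb_orr orbC.
by apply: leq_trans (leq_card_setU _ _) _; rewrite leq_add2r.
Qed.

Lemma packing_cycle h D g : 0 < h -> 0 < g -> exists N0, forall N, N0 <= N ->
  forall (V : finType) (G : rel V) (side : V -> bool) (U X Y : {set V}) f,
  symmetric G -> (forall x y, G x y -> side x != side y) ->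
  linked G D f U -> N <= g * f -> X \subset U -> Y \subset U ->
  {in X, forall x, side x} -> {in Y, forall y, ~~ side y} ->
  #|X| <= N -> #|Y| <= N ->
  exists E : {set V * V}, [/\ E \subset setX X Y,
     {in E &, injective fst} /\ {in E &, injective snd},
     h * edges G (X :\: fst @: E) (Y :\: snd @: E) < N ^ 2,
     h * #|rich G h N (X :\: fst @: E) (Y :\: snd @: E) E| < N &
     forall k, N <= h * k -> h * k + N <= h * #|E| ->
       exists c, [/\ cycle G c, uniq c & size c = 2 * k]].
Proof.
(* A class with threshold [thr t] loses [c * thr t] by [lower_reg_flexible] at density
   [1 / (2 * h)], and if it is dropped as too short at most [thr t] more, since
   [D + 2 <= m <= thr t]. This [q] turns the invariant on the sum of thresholds into a total loss of
   at most [N / h]. *)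
move=> h0 g0; pose c := 5 * (2 * h) ^ 2; pose q := 2 * (c.+1 * h).
have q1 : 1 < q by rewrite /q leq_pmulr // muln_gt0.
pose Q := q ^ (2 * h * q ^ 2); pose L := Q ^ (2 * h * Q ^ 2).
have Q0 : 0 < Q by rewrite expn_gt0 (ltnW q1).
have L0 : 0 < L by rewrite expn_gt0 Q0.
have hL0 : 0 < h * L by rewrite muln_gt0 h0.
(* [K0] bounds the number of classes, because every threshold is at least [m] and
   [N <= 2 * (h * L) * m]. Hence the obstacle size [f0] needed to string all blocks together is
   independent of [N]. *)
pose K0 := 2 * (h * L); pose f0 := D + (D + 2) * K0.
exists (h * L * (f0 + (D + 2)) + g * f0 + h * f0) => N leN.
move=> V G side U X Y f symG bip lk Nf XU YU sX sY XN YN.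
pose m := N %/ (h * L).
have [||mN mbig Nm] := @divn_bounds N (h * L) (f0 + (D + 2)) hL0.
- by rewrite addn_gt0 addn2 orbT.
- by apply: leq_trans leN; rewrite -addnA leq_addr.
rewrite -/m in mN mbig Nm.
have m0 : 0 < m by apply: leq_trans mbig; rewrite addn_gt0 addn2 orbT.
have N0 : 0 < N by apply: leq_trans mN; rewrite muln_gt0 hL0.
have mf0 : f0 <= m by apply: leq_trans mbig; rewrite leq_addr.
have mD : D + 2 <= m by apply: leq_trans mbig; rewrite leq_addl.
have ff0 : f0 <= f.
  rewrite -(leq_pmul2l g0); apply: leq_trans Nf; apply: leq_trans leN.
  by rewrite -addnA addnCA leq_addr.
have hmN : h * (m * L) <= N by apply: leq_trans mN; rewrite -mulnA (mulnC L).
have [E [lab [thr [K [pE sE unm ri]]]]] := max_packing symG h0 q1 m0 N0 XN YN hmN.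
exists E; have [EXY inj1 inj2 labK reg] := pE; split=> //.
move=> k Nk kE.
pose A t := fst @: label_class E lab t; pose B t := snd @: label_class E lab t.
have clE t e : e \in label_class E lab t -> e \in E by rewrite inE => /andP[].
have cA t : #|A t| = #|label_class E lab t|.
  by rewrite card_in_imset // => e e' /clE eE /clE; exact: inj1.
have cB t : #|B t| = #|label_class E lab t|.
  by rewrite card_in_imset // => e e' /clE eE /clE; exact: inj2.
have AX t x : x \in A t -> x \in X.
  by move=> /imsetP[e /clE /(subsetP EXY)]; rewrite inE => /andP[eX _] ->.
have BY t x : x \in B t -> x \in Y.
  by move=> /imsetP[e /clE /(subsetP EXY)]; rewrite inE => /andP[_ eY] ->.
pose kap t := #|A t| - c * thr t.
have EN : #|E| <= N.
  have <- : #|fst @: E| = #|E| by rewrite card_in_imset.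
  apply: leq_trans XN; apply: subset_leq_card; apply/subsetP => x /imsetP[e eE ->].
  by have := subsetP EXY _ eE; rewrite inE => /andP[].
have KK0 : K <= K0.
  rewrite -(leq_pmul2r m0) /K0; apply: leq_trans Nm.
  apply: leq_trans EN; rewrite -(leq_pmul2l (ltn0Sn 1)); apply: leq_trans sE.
  apply: leq_mul q1 _.
  by rewrite -{1}(card_ord K) -sum_nat_const; apply: leq_sum => t _; case: (reg t).
pose good t := D + 2 <= kap t.
pose ts := [seq t <- iota 0 K | good t].
pose bs := [seq (A t :|: B t, kap t) | t <- ts].
have tsK t : t \in ts -> t < K /\ good t.
  by rewrite mem_filter mem_iota add0n => /andP[gt /andP[_ tK]].
have blk C : C \in bs -> block G side U f0 C.1 C.2.
  move=> /mapP[t /tsK[tK gt] ->] F cF /=.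
  have [mt regt] := reg t tK.
  have tau : 0 < thr t := leq_trans m0 mt.
  have dAB : [disjoint A t & B t].
    rewrite -setI_eq0; apply/eqP/setP => x; rewrite !inE; apply/negP => /andP[xA xB].
    by have := sY _ (BY _ _ xB); rewrite (sX _ (AX _ _ xA)).
  have h20 : 0 < 2 * h by rewrite muln_gt0.
  have [||||a [b [aA bB flex]]] := lower_reg_flexible symG (F := F) (f := f0) regt h20 tau dAB.
  - by rewrite -/(A t) -/(B t) cA cB.
  - exact: leq_trans mt.
  - by rewrite -subn_gt0 -/(A t); apply: leq_trans gt; rewrite addn2.
  - by [].
  move: aA bB; rewrite -/(A t) -/(B t) => /setDP[aA aF] /setDP[bB bF].
  exists a, b; split.
  - by rewrite !inE aF aA (subsetP XU) // (AX t).
  - by rewrite !inE bF bB orbT (subsetP YU) // (BY t).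
  - by apply: sX; exact: AX aA.
  - by apply: sY; exact: BY bB.
  - exact: flex.
have big : all (fun C : {set V} * nat => D + 2 <= C.2) bs.
  by rewrite all_map; apply/allP => t /tsK[].
have dis : pairwise (fun C C' : {set V} * nat => [disjoint C.1 & C'.1]) bs.
  rewrite pairwise_map; have : uniq ts by rewrite filter_uniq ?iota_uniq.
  rewrite uniq_pairwise; apply: sub_pairwise => t t' /= tt'.
  have lab_eq x y (e e' : V * V) : e \in label_class E lab x -> e' \in label_class E lab y -> e = e' -> x = y.
    by rewrite !inE => /andP[_ /eqP <-] /andP[_ /eqP <-] ->.
  rewrite -setI_eq0; apply/eqP/setP => x; rewrite [RHS]inE; apply/negP.
  rewrite in_setI !in_setU => /andP[/orP[]xA /orP[]xB].
  - case/imsetP: xA xB => e eE -> /imsetP[e' eE' ee].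
    by move/eqP: tt'; apply; apply: lab_eq eE eE' (inj1 _ _ (clE _ _ eE) (clE _ _ eE') ee).
  - by move: (sX _ (AX _ _ xA)) (sY _ (BY _ _ xB)) => ->.
  - by move: (sX _ (AX _ _ xB)) (sY _ (BY _ _ xA)) => ->.
  - case/imsetP: xA xB => e eE -> /imsetP[e' eE' ee].
    by move/eqP: tt'; apply; apply: lab_eq eE eE' (inj2 _ _ (clE _ _ eE) (clE _ _ eE') ee).
have sumk : #|E| <= sumn (map snd bs) + c.+1 * \sum_(t < K) thr t.
  apply: leq_trans (card_class_sum labK) _.
  have -> : sumn (map snd bs) = \sum_(t < K | good t) kap t.
    by rewrite -map_comp sumnE big_map big_filter -[X in iota 0 X]subn0 big_mkord.
  rewrite [X in _ <= X + _]big_mkcond big_distrr /= -big_split /=; apply: leq_sum => t _.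
  have [mt _] := reg t (ltn_ord t).
  rewrite -cA mulSn; case: ifP => gt.
    rewrite addnCA; apply: leq_trans (leq_addl _ _).
    by rewrite /kap; move: (c * _) => y; clear; lia.
  have : kap t < D + 2 by rewrite ltnNge; apply: negbT.
  by rewrite /kap => /sub_lt_bound; apply; exact: leq_trans mt.
have kbs : k <= sumn (map snd bs).
  rewrite -(leq_pmul2l h0) -(leq_add2r N); apply: leq_trans kE _.
  apply: leq_trans (leq_mul (leqnn h) sumk) _.
  rewrite mulnDr leq_add2l mulnA (mulnC h).
  rewrite -(leq_pmul2l (ltn0Sn 1)) mulnA.
  apply: leq_trans sE _; by rewrite leq_mul2l EN.
have f0k : f0 <= k.
  rewrite -(leq_pmul2l h0); apply: leq_trans Nk; apply: leq_trans leN.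
  by rewrite leq_addl.
have szbs : size bs <= K.
  by rewrite size_map size_filter (leq_trans (count_size _ _)) // size_iota.
have lkf0 : linked G D f0 U by move=> F cF; apply: lk; exact: leq_trans ff0.
have f0bs : D + (D + 2) * size bs <= f0.
  by rewrite leq_add2l leq_mul2l (leq_trans szbs KK0) orbT.
move: blk big dis kbs f0bs; case: (bs) => [|C0 bs'] blk big dis kbs f0bs.
  have : 0 < k by apply: leq_trans (leq_trans N0 Nk) _; move: kbs; case: (k) => //; rewrite muln0 in N0 *.
  by rewrite lt0n; move: kbs; rewrite leqn0 => ->.
by apply: (cycle_of_blocks bip lkf0 blk big dis f0bs); rewrite kbs andbT (leq_trans f0bs).
Qed.

(** The seed, the vertices of good degree in one regular pair, fixes [C]; absorbing vertices until
    the boundary is sparse only increases [D] and [g2]. Thus [g] may later be chosen in terms of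
    [C]. *)
Lemma hub_grow h : 0 < h -> exists2 C, 0 < C & forall g, 0 < g -> exists D g2 N0, 0 < g2 /\
  forall N, N0 <= N ->
  forall (V : finType) (G : rel V) (S T Z : {set V}), symmetric G ->
  S \subset Z -> T \subset Z -> #|S| <= N -> #|T| <= N -> #|Z| <= 2 * N ->
  N ^ 2 <= h * edges G S T ->
  exists (U : {set V}) f, [/\ U \subset Z, linked G D f U /\ N <= g2 * f, N <= C * #|U :&: S|,
     N <= C * #|U :&: T| & g * edges G U (Z :\: U) <= N ^ 2].
Proof.
move=> h0; pose q := 8 * h; pose L := q ^ (2 * h * q ^ 2); pose d := h * L.
have q1 : 1 < q by rewrite /q; move: h0; clear; lia.
have L0 : 0 < L by rewrite expn_gt0 (ltnW q1).
have d0 : 0 < d by rewrite muln_gt0 h0.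
exists (2 * d) => [|g g0]; first by rewrite muln_gt0.
(* With [f] close to [N / d'], a boundary of at most [4 * N * f] edges is at most [N ^ 2 / g], and
   [n] exceeds [4 * d'] so that [2 * N < n * f]. *)
pose d' := 4 * g * d.
have d'0 : 0 < d' by rewrite muln_gt0 d0 andbT muln_gt0 g0.
pose n := (4 * d').+1.
exists (4 + 2 * n), (2 * d'), d'; split; first by rewrite muln_gt0.
move=> N leN V G S T Z symG SZ TZ SN TN ZN dense.
have dd' : d <= d' by rewrite leq_pmull // muln_gt0.
have [|mN mpos Nm] := @divn_bounds N d 1 d0 (ltn0Sn 0).
  by rewrite muln1 (leq_trans dd').
have [|fN fpos Nf] := @divn_bounds N d' 1 d'0 (ltn0Sn 0); first by rewrite muln1.
set m := N %/ d in mN mpos Nm; set f := N %/ d' in fN fpos Nf.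
have fm : f <= m by exact: leq_div2l.
have N0 : 0 < N := leq_trans d'0 leN.
have big a b : b <= N -> N ^ 2 <= h * (a * b) -> m * L <= a.
  move=> bN; rewrite -mulnn => le; rewrite -(leq_pmul2l h0).
  have -> : h * (m * L) = d * m by rewrite /d -mulnA (mulnC L).
  apply: leq_trans mN _; rewrite -(leq_pmul2r N0); apply: leq_trans le _.
  by rewrite mulnA leq_mul2l bN orbT.
have dST := leq_trans dense (leq_mul (leqnn h) (edges_le G S T)).
have [|||i iJ [A [B [AS BT cA cB reg]]]] := lower_reg_subpair symG (S := S) (T := T) h0 q1 mpos.
- exact: big TN dST.
- by apply: (big _ _ SN); rewrite (mulnC #|T|).
- by apply: leq_trans dense; rewrite -mulnn leq_mul.
set t := m * q ^ i in reg.
have mt : m <= t by rewrite leq_pmulr // expn_gt0 (ltnW q1).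
have t0 : 0 < t := leq_trans mpos mt.
have sE : m * q ^ i.+1 = q * t by rewrite expnS mulnCA.
rewrite sE in cA cB.
have qt : 8 * t <= q * t by rewrite leq_mul2r leq_pmulr ?orbT.
have h20 : 0 < 2 * h by rewrite muln_gt0.
pose Ag := [set a in A | 2 * t <= deg G B a].
pose Bg := [set b in B | 2 * t <= deg G A b].
have lk : linked G 4 f (Ag :|: Bg).
  apply: hub_linked reg h20 t0 (leq_trans fm mt) _ _ => //.
    by rewrite cA (leq_trans _ qt) // leq_mul2r orbT.
  by rewrite cB (leq_trans _ qt) // leq_mul2r orbT.
have few A1 B1 : lower_reg G (2 * h) t A1 B1 -> #|A1| = q * t -> #|B1| = q * t ->
    m <= #|[set a in A1 | 2 * t <= deg G B1 a]|.
  move=> reg1 cA1 cB1.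
  have bad : #|[set a in A1 | deg G B1 a < 2 * t]| < t.
    apply: few_low_deg reg1 t0 _ _; first by rewrite cB1 leq_pmull // (ltnW q1).
    by rewrite cB1 /q; clear; lia.
  have sub : A1 \subset [set a in A1 | 2 * t <= deg G B1 a] :|: [set a in A1 | deg G B1 a < 2 * t].
    by apply/subsetP => a aA; rewrite !inE aA /=; case: leqP.
  have := leq_trans (subset_leq_card sub) (leq_card_setU _ _).
  by rewrite cA1; exact: few_low_arith mt qt bad.
have cAg : m <= #|Ag| by exact: few.
have cBg : m <= #|Bg| by apply: few (lower_regC symG reg) _ _.
have AgS : Ag \subset S by apply: subset_trans AS; apply/subsetP => x; rewrite inE => /andP[].
have BgT : Bg \subset T by apply: subset_trans BT; apply/subsetP => x; rewrite inE => /andP[].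
have UZ : Ag :|: Bg \subset Z.
  by rewrite subUset (subset_trans AgS SZ) (subset_trans BgT TZ).
have [|U [sU U'Z lkU fewU]] := linked_grow symG (n := n) UZ lk.
  apply: leq_ltn_trans (subset_leq_card (subsetDl _ _)) _.
  apply: leq_ltn_trans ZN _; rewrite /n mulSn.
  have le : 2 * N <= 4 * d' * f by rewrite -[4]/(2 * 2) -!(mulnA 2) leq_mul2l /= mulnA.
  by apply: leq_ltn_trans le _; rewrite -[X in X < _]add0n ltn_add2r.
exists U, f; split=> //.
- apply: leq_trans Nm _; rewrite leq_mul2l; apply/orP; right.
  apply: leq_trans cAg _; apply: subset_leq_card; rewrite subsetI AgS andbT.
  by apply: subset_trans sU; exact: subsetUl.
- apply: leq_trans Nm _; rewrite leq_mul2l; apply/orP; right.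
  apply: leq_trans cBg _; apply: subset_leq_card; rewrite subsetI BgT andbT.
  by apply: subset_trans sU; exact: subsetUr.
set W := [set w in Z :\: U | f < deg G U w] in fewU.
have UN : #|U| <= 2 * N by apply: leq_trans ZN; exact: subset_leq_card.
have DN : #|Z :\: U| <= 2 * N by apply: leq_trans ZN; apply: subset_leq_card; exact: subsetDl.
(* A vertex outside [U] sends at most [f] edges to it, apart from at most [f] vertices that may send
   [2 * N]. *)
have le : edges G U (Z :\: U) <= 4 * N * f.
  rewrite edgesC // /edges.
  apply: leq_trans (_ : \sum_(w in Z :\: U) (f + (w \in W) * (2 * N)) <= _).
    apply: leq_sum => w wZ; have [wW|wW] := boolP (w \in W).
      by rewrite mul1n; apply: leq_trans (leq_addl _ _); apply: leq_trans UN; exact: deg_le.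
    by rewrite addn0; move: wW; rewrite inE wZ /= -leqNgt.
  rewrite big_split /= sum_nat_const -big_distrl /=.
  have -> : \sum_(w in Z :\: U) (w \in W) = #|W|.
    rewrite -sum1_card [LHS](bigID (mem W)) /= [X in _ + X]big1 ?addn0.
      apply: eq_big => w; last by move=> /andP[_ ->].
      by rewrite /W !inE; case: (w \in U) (w \in Z) => [] [].
    by move=> w /andP[_ /negbTE ->].
  have : #|Z :\: U| * f <= 2 * N * f by rewrite leq_mul2r DN orbT.
  have : #|W| * (2 * N) <= f * (2 * N) by rewrite leq_mul2r fewU orbT.
  by clear; lia.
apply: leq_trans (leq_mul (leqnn g) le) _.
have -> : g * (4 * N * f) = 4 * g * f * N by clear; lia.
rewrite -mulnn leq_mul2r; apply/orP; right; apply: leq_trans fN.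
by rewrite leq_mul2r /d' leq_pmulr ?orbT.
Qed.

(** * A colour dense on all large rectangles *)

Lemma prod_small C g c N x y : 0 < N -> N <= C * x -> g * (x * y) <= c * N ^ 2 ->
  g * y <= C * c * N.
Proof.
move=> N0 NC le; rewrite -(leq_pmul2r N0).
have : g * y * N <= g * y * (C * x) by rewrite leq_mul2l NC orbT.
have : C * (g * (x * y)) <= C * (c * N ^ 2) by rewrite leq_mul2l le orbT.
by rewrite -mulnn; clear; lia.
Qed.

Section Density.
Variable V : finType.
Implicit Types (G : rel V) (S T L R : {set V}).

Definition has_cycle G k := exists c, [/\ cycle G c, uniq c & size c = 2 * k].

(* Up to [N ^ 2 / g] edges, [G] is complete between [S] and [T]; [covered] is the same for
   the union of two graphs. *)
Definition nearly G g N S T := forall S' T', S' \subset S -> T' \subset T ->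
  g * (#|S'| * #|T'|) <= g * edges G S' T' + N ^ 2.

Definition covered G1 G2 g N S T := forall S' T', S' \subset S -> T' \subset T ->
  g * (#|S'| * #|T'|) <= g * (edges G1 S' T' + edges G2 S' T') + N ^ 2.

Definition separated (side : V -> bool) S T :=
  {in S, forall x, side x} /\ {in T, forall x, ~~ side x}.

Lemma separated_sub side S T S' T' : S' \subset S -> T' \subset T ->
  separated side S T -> separated side S' T'.
Proof.
by move=> /subsetP SS /subsetP TT [s1 s2]; split=> x; [move/SS/s1|move/TT/s2].
Qed.

Lemma separatedC side S T : separated side S T -> separated (fun x => ~~ side x) T S.
Proof. by move=> [s1 s2]; split=> x; [apply: s2|rewrite negbK; apply: s1]. Qed.

Lemma separated_disjoint side S T : separated side S T -> [disjoint S & T].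
Proof.
move=> [s1 s2]; rewrite -setI_eq0; apply/eqP/setP => x; rewrite !inE.
by apply/negP => /andP[/s1 xs /s2]; rewrite xs.
Qed.

Lemma coveredC G1 G2 g N S T : covered G1 G2 g N S T -> covered G2 G1 g N S T.
Proof. by move=> c S' T' sS sT; rewrite (addnC (edges G2 _ _)); exact: c. Qed.

Lemma covered_sub G1 G2 g N S T S' T' : S' \subset S -> T' \subset T ->
  covered G1 G2 g N S T -> covered G1 G2 g N S' T'.
Proof.
by move=> sS sT c S1 T1 S1S T1T; apply: c; [exact: subset_trans sS|exact: subset_trans sT].
Qed.

Lemma coveredr G1 G2 g N S T : symmetric G1 -> symmetric G2 ->
  covered G1 G2 g N S T -> covered G1 G2 g N T S.
Proof. by move=> s1 s2 c T' S' sT sS; rewrite (mulnC #|_|) edgesC // (edgesC s2) c. Qed.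

Lemma scale_le g g' x y n : g <= g' -> g' * x <= g' * y + n -> g * x <= g * y + n.
Proof.
move=> gg' h; have [xy|yx] := leqP x y; first by apply: leq_trans (leq_addr _ _); rewrite leq_mul2l xy orbT.
have : g * (x - y) <= g' * (x - y) by rewrite leq_mul2r gg' orbT.
have xE : x = y + (x - y) by rewrite subnKC // ltnW.
move: h; rewrite xE addKn !mulnDr; move: (x - y) => z; clear; lia.
Qed.

Lemma covered_le G1 G2 g g' N S T : g <= g' ->
  covered G1 G2 g' N S T -> covered G1 G2 g N S T.
Proof. by move=> gg' c S' T' sS sT; apply: scale_le gg' _; exact: c. Qed.

Lemma covered_sparse G1 G2 g N S T : symmetric G1 ->
  covered G1 G2 (2 * g) N S T -> 2 * g * edges G1 S T <= N ^ 2 -> nearly G2 g N S T.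
Proof.
move=> sG c e S' T' sS sT; have := c S' T' sS sT.
have : 2 * g * edges G1 S' T' <= 2 * g * edges G1 S T by rewrite leq_mul2l edges_subset ?orbT.
move: e; clear; lia.
Qed.

End Density.

Section Unmatched.
Variables (V : finType) (G : rel V).
Hypothesis symG : symmetric G.

(** After removal of the [q]-ends with many unmatched neighbours, [Y] consists of unmatched
    vertices, sparse to [X :\: p @: E] by maximality, and matched vertices of small degree to it.
    The projections are variables so that both sides are served. *)
Lemma unmatched_sparse (p q : V * V -> V) (A X Y : {set V}) (E : {set V * V}) h N :
  {in E &, injective q} -> q @: E \subset Y -> #|E| <= N ->
  h * edges G (X :\: p @: E) (Y :\: q @: E) < N ^ 2 ->
  h * edges G A Y <= 2 * N ^ 2 ->
  h * edges G (A :|: (X :\: p @: E))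
     (Y :\: q @: [set e in E | N <= h * deg G (X :\: p @: E) (q e)]) <= 4 * N ^ 2.
Proof.
move=> injq qE EN; set X' := X :\: _; set Y' := Y :\: _; set I := [set e in E | _] => unm AY.
pose J := E :\: I.
have sub : Y :\: q @: I \subset Y' :|: q @: J.
  apply/subsetP => y /setDP[yY yI]; rewrite !inE yY andbT.
  have [/imsetP[e eE ye]|//] := boolP (y \in q @: E); rewrite /=.
  rewrite ye imset_f // inE eE andbT; apply: contra yI => eI.
  by rewrite ye imset_f.
have e1 : edges G (A :|: X') (Y :\: q @: I) <= edges G A Y + (edges G X' Y' + edges G X' (q @: J)).
  apply: leq_trans (edgesUl_le _ _ _ _) _; apply: leq_add.
    by apply: edges_subset; rewrite ?subsetDl.
  by apply: leq_trans (edgesUr_le symG _ _ _); exact: edges_subset.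
have e2 : h * edges G X' (q @: J) <= N ^ 2.
  rewrite edgesC // /edges big_distrr /=.
  apply: leq_trans (_ : \sum_(y in q @: J) N <= _).
    apply: leq_sum => y /imsetP[e eJ ->]; move: eJ; rewrite !inE => /andP[+ eE].
    by rewrite eE /= -ltnNge => /ltnW.
  rewrite sum_nat_const -mulnn leq_mul2r; apply/orP; right.
  apply: leq_trans (leq_imset_card _ _) _; apply: leq_trans EN.
  by apply: subset_leq_card; exact: subsetDl.
apply: leq_trans (leq_mul (leqnn h) e1) _; rewrite !mulnDr.
by move: AY unm e2; move: (N ^ 2) => M; clear; lia.
Qed.

Lemma card_unmatched (q : V * V -> V) (Y : {set V}) (E I : {set V * V}) :
  {in E &, injective q} -> q @: E \subset Y -> I \subset E ->
  #|Y :\: q @: I| + #|I| = #|Y|.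
Proof.
move=> injq qE IE; have qIY : q @: I \subset Y by apply: subset_trans qE; exact: imsetS.
have cI : #|q @: I| = #|I|.
  by apply: card_in_imset => e e' /(subsetP IE) eE /(subsetP IE); exact: injq.
by rewrite cardsD (setIidPr qIY) -cI subnK // subset_leq_card.
Qed.

End Unmatched.

Lemma imset_fst_sub (V : finType) (E : {set V * V}) (X Y : {set V}) :
  E \subset setX X Y -> fst @: E \subset X.
Proof. by move=> /subsetP s; apply/subsetP => x /imsetP[e /s]; rewrite inE => /andP[? _] ->. Qed.

Lemma imset_snd_sub (V : finType) (E : {set V * V}) (X Y : {set V}) :
  E \subset setX X Y -> snd @: E \subset Y.
Proof. by move=> /subsetP s; apply/subsetP => x /imsetP[e /s]; rewrite inE => /andP[_ ?] ->. Qed.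

Lemma card_setI_setD (V : finType) (B A : {set V}) : #|B :&: A| + #|A :\: B| = #|A|.
Proof. by rewrite setIC cardsID. Qed.

(** Here [i] and [j] count matched pairs whose right, respectively left, end sees many unmatched
    vertices, and [r] the pairs of both kinds. The lower bounds give [i + j > 2N - 4M], the upper
    ones [i + j < N - M + N / 9]. *)
Lemma count_arith N M x y i j e r : 4 * M <= N -> N < x + M -> N < y + M ->
  e + M < N -> x < M + i -> y < M + j -> i + j <= e + r -> 9 * r < N -> False.
Proof. lia. Qed.

(* The giant component is the set [U] grown outside a maximal set [W] with sparse boundary
   and both sides smaller than [M]. *)
Lemma cycle_of_dense h : 0 < h -> exists N0, forall N, N0 <= N ->
  forall (V : finType) (G : rel V) (side : V -> bool) (L R : {set V}) M,
  symmetric G -> (forall x y, G x y -> side x != side y) -> separated side L R ->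
  #|L| = N -> #|R| = N -> 4 * M <= N ->
  (forall S T : {set V}, S \subset L -> T \subset R -> M <= #|S| -> M <= #|T| ->
     N ^ 2 <= h * edges G S T) ->
  forall k, N <= h * k -> h * k + h * M + N <= h * N -> has_cycle G k.
Proof.
(* The factor 9 exceeds the 4 of [unmatched_sparse], so that density on [M x M] rectangles is
   contradicted, and it keeps the number of rich pairs below [N / 9]. *)
move=> h0; pose g1 := 9 * h; have g10 : 0 < g1 by rewrite muln_gt0.
have [C C0 hub] := hub_grow h0.
have [D [g2 [N1 [g20 hubg]]]] := hub (g1 * C) ltac:(by rewrite muln_gt0 g10).
have [N2 pc] := packing_cycle D g10 g20.
exists (N1 + N2).+1 => N leN V G side L R M symG bip sep cL cR MN H k Nk kN.
have N0 : 0 < N by apply: leq_trans leN.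
have leN1 : N1 <= N by apply: leq_trans leN; rewrite leqW // leq_addr.
have leN2 : N2 <= N by apply: leq_trans leN; rewrite leqW // leq_addl.
have NN0 : 0 < N ^ 2 by rewrite expn_gt0 N0.
have dLR := separated_disjoint sep.
pose Z := L :|: R.
have cZ : #|Z| = 2 * N.
  by rewrite cardsU disjoint_setI0 // cards0 subn0 cL cR mul2n addnn.
have LZ : L \subset Z by exact: subsetUl.
have RZ : R \subset Z by exact: subsetUr.
have M0 : 0 < M.
  rewrite lt0n; apply/negP => /eqP M0.
  have := H set0 set0 (sub0set _) (sub0set _); rewrite M0 => /(_ isT isT).
  by rewrite /edges big_set0 muln0 leqNgt NN0.
(* The boundary is charged to [#|W| * N], so that adjoining a set with its own sparse boundary
   preserves the last condition. *)
pose ok (W : {set V}) := [/\ W \subset Z, #|W :&: L| < M, #|W :&: R| < M &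
  g1 * edges G W (Z :\: W) <= #|W| * N].
have [||n [[W [[WZ WL WR We] Wn]] max]] :=
    @ex_max_nat (fun n => exists W : {set V}, ok W /\ #|W| = n) #|V|.
- exists 0, set0; split; last by rewrite cards0.
  split; rewrite ?set0I ?cards0 ?sub0set //.
  by rewrite /edges big_set0 muln0.
- by move=> n [W [_ <-]]; exact: max_card.
pose Z' := Z :\: W.
have cLW := card_setI_setD W L; have cRW := card_setI_setD W R.
have LW : M <= #|L :\: W| by move: cLW WL MN; rewrite cL; clear; lia.
have RW : M <= #|R :\: W| by move: cRW WR MN; rewrite cR; clear; lia.
have [||||||U [f [UZ' [lkU Nf] UL UR Ue]]] :=
    hubg N leN1 V G (L :\: W) (R :\: W) Z' symG.
- exact: setSD.
- exact: setSD.
- by rewrite -cL subset_leq_card // subsetDl.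
- by rewrite -cR subset_leq_card // subsetDl.
- by rewrite -cZ subset_leq_card // subsetDl.
- by apply: H; rewrite ?subsetDl.
have UZ : U \subset Z by apply: subset_trans UZ' _; exact: subsetDl.
have UW : [disjoint W & U].
  rewrite disjoint_sym; apply: disjointWl UZ' _.
  by rewrite -setI_eq0 setIC /Z' setDE setICA setICr setI0.
have cUC : N <= C * #|U|.
  by apply: leq_trans UL _; rewrite leq_mul2l subset_leq_card ?subsetIl ?orbT.
have Ue' : g1 * edges G U (Z' :\: U) <= #|U| * N.
  rewrite -(leq_pmul2l C0) mulnCA mulnA; apply: leq_trans Ue _.
  by rewrite -mulnn mulnA leq_mul2r cUC orbT.
have cU0 : 0 < #|U|.
  by move: cUC N0; case: #|U| => //; rewrite muln0 leqNgt => /negP h1 /h1.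
pose W' := W :|: U.
have cW' : #|W'| = #|W| + #|U| by rewrite cardsU disjoint_setI0 // cards0 subn0.
have W'Z : W' \subset Z by rewrite subUset WZ.
have W'e : g1 * edges G W' (Z :\: W') <= #|W'| * N.
  rewrite cW' mulnDl; apply: leq_trans (leq_add We Ue').
  rewrite -mulnDr leq_mul2l; apply/orP; right.
  apply: leq_trans (edgesUl_le _ _ _ _) _; rewrite /Z' setDDl -/W' leq_add2r.
  by apply: edges_subset => //; apply: setDS; exact: subsetUl.
have U'e : g1 * edges G U (Z :\: U) <= #|W'| * N.
  rewrite cW' mulnDl; apply: leq_trans (leq_add We Ue').
  rewrite -mulnDr leq_mul2l; apply/orP; right.
  apply: leq_trans (_ : edges G U (W :|: (Z' :\: U)) <= _).
    apply: edges_subset => //; apply/subsetP => x; rewrite !inE.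
    by case: (x \in W) => //= /andP[-> ->].
  apply: leq_trans (edgesUr_le symG _ _ _) _; rewrite leq_add2r edgesC //.
  exact: edges_subset.
have sparse (A S T : {set V}) : A \subset Z -> g1 * edges G A (Z :\: A) <= #|W'| * N ->
    S \subset A -> T \subset Z :\: A -> g1 * edges G S T <= 2 * N ^ 2.
  move=> AZ Ae SA TA; apply: leq_trans (_ : #|W'| * N <= _).
    by apply: leq_trans Ae; rewrite leq_mul2l edges_subset ?orbT.
  rewrite -mulnn mulnA leq_mul2r; apply/orP; right.
  by rewrite -cZ subset_leq_card.
have few (S T : {set V}) : S \subset L -> T \subset R -> g1 * edges G S T <= 4 * N ^ 2 ->
    M <= #|S| -> #|T| < M.
  move=> SL TR e MS; rewrite ltnNge; apply/negP => MT.
  have := H S T SL TR MS MT; move: e NN0; rewrite /g1; move: (N ^ 2) => y; clear; lia.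
have few' (S T : {set V}) : S \subset L -> T \subset R -> g1 * edges G S T <= 4 * N ^ 2 ->
    M <= #|T| -> #|S| < M.
  move=> SL TR e MT; rewrite ltnNge; apply/negP => MS.
  by have := few S T SL TR e MS; rewrite ltnNge MT.
have s24 x : x <= 2 * N ^ 2 -> x <= 4 * N ^ 2.
  by move=> /leq_trans; apply; rewrite leq_mul2r orbT.
(* If [A] has [M] vertices on one side, sparsity of its boundary leaves fewer than [M] outside it on
   the other side, so [A] is large there too and the argument can be reversed. *)
have LR_closed (A : {set V}) : A \subset Z -> g1 * edges G A (Z :\: A) <= #|W'| * N ->
    M <= #|A :&: L| \/ M <= #|A :&: R| -> #|L :\: A| < M /\ #|R :\: A| < M.
  move=> AZ Ae.
  have cA := card_setI_setD A L; have cA' := card_setI_setD A R.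
  have h1 : M <= #|A :&: L| -> #|R :\: A| < M.
    apply: few; rewrite ?subsetIr ?subsetDl // s24 //.
    by apply: (sparse _ _ _ AZ Ae); rewrite ?subsetIl ?setSD.
  have h2 : M <= #|A :&: R| -> #|L :\: A| < M.
    apply: few'; rewrite ?subsetIr ?subsetDl // s24 // edgesC //.
    by apply: (sparse _ _ _ AZ Ae); rewrite ?subsetIl ?setSD.
  case=> [/[dup] MA /h1 lt|/[dup] MA /h2 lt]; split=> //; [apply: h2|apply: h1].
    by move: cA' lt MN; rewrite cR; clear; lia.
  by move: cA lt MN; rewrite cL; clear; lia.
have [LW' RW'] : #|L :\: W'| < M /\ #|R :\: W'| < M.
  apply: (LR_closed _ W'Z W'e).
  have [lt|] := ltnP #|W' :&: L| M; last by left.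
  have [lt'|] := ltnP #|W' :&: R| M; last by right.
  have : #|W'| <= n by apply: max; exists W'.
  by rewrite cW' -Wn -{2}[#|W|]addn0 leq_add2l leqNgt cU0.
(* [W] and the complement of [W'] each contain fewer than [M] vertices of [L], so [U] contains more
   than [N - 2M >= M]. *)
have [LU RU] : #|L :\: U| < M /\ #|R :\: U| < M.
  apply: (LR_closed _ UZ U'e); left.
  have : #|L| <= #|W :&: L| + #|U :&: L| + #|L :\: W'|.
    rewrite -(card_setI_setD W' L) leq_add2r /W' setIUl.
    exact: (leq_card_setU _ _).1.
  by rewrite cL; move: WL LW' MN; clear; lia.
pose X := U :&: L; pose Y := U :&: R.
have XL : X \subset L by exact: subsetIr.
have YR : Y \subset R by exact: subsetIr.
have XU : X \subset U by exact: subsetIl.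
have YU : Y \subset U by exact: subsetIl.
have cX := card_setI_setD U L; have cY := card_setI_setD U R.
rewrite cL -/X in cX; rewrite cR -/Y in cY.
have [sX sY] := separated_sub XL YR sep.
have [||E [EXY [inj1 inj2] unm ri cyc]] :=
   pc N leN2 V G side U X Y f symG bip lkU Nf XU YU sX sY.
- by rewrite -cX leq_addr.
- by rewrite -cY leq_addr.
have E1 := imset_fst_sub EXY; have E2 := imset_snd_sub EXY.
have EN : #|E| <= N.
  rewrite -(card_in_imset inj1); apply: leq_trans (subset_leq_card E1) _.
  by rewrite -cX leq_addr.
have bigE : N <= #|E| + M.
  rewrite leqNgt; apply/negP => smallE.
  pose X' := X :\: fst @: E; pose Y' := Y :\: snd @: E.
  pose I := [set e in E | N <= g1 * deg G X' e.2].
  pose J := [set e in E | N <= g1 * deg G Y' e.1].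
  have cLU : L :\: fst @: E = (L :\: U) :|: X'.
    apply/setP => x; rewrite /X' /X !inE.
    have [xE|xE] := boolP (x \in fst @: E); last by case: (x \in U); rewrite /= ?orbF.
    by have := subsetP E1 x xE; rewrite inE => /andP[-> ->].
  have cRU : R :\: snd @: E = (R :\: U) :|: Y'.
    apply/setP => x; rewrite /Y' /Y !inE.
    have [xE|xE] := boolP (x \in snd @: E); last by case: (x \in U); rewrite /= ?orbF.
    by have := subsetP E2 x xE; rewrite inE => /andP[-> ->].
  have cI := card_unmatched (I := I) inj2 E2 ltac:(by apply/subsetP => e; rewrite inE => /andP[]).
  have cJ := card_unmatched (I := J) inj1 E1 ltac:(by apply/subsetP => e; rewrite inE => /andP[]).
  have cLE := card_unmatched inj1 (subset_trans E1 XL) (subxx E).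
  have cRE := card_unmatched inj2 (subset_trans E2 YR) (subxx E).
  have lt1 : #|Y :\: snd @: I| < M.
    apply: (few (L :\: fst @: E)); rewrite ?subsetDl //.
    - by apply: subset_trans (subsetDl _ _) YR.
    - rewrite cLU; apply: unmatched_sparse unm _ => //.
      rewrite edgesC //; apply: (sparse _ _ _ UZ U'e YU); exact: setSD.
    - by move: cLE smallE; rewrite cL; clear; lia.
  have lt2 : #|X :\: fst @: J| < M.
    apply: (few' _ (R :\: snd @: E)); rewrite ?subsetDl //.
    - by apply: subset_trans (subsetDl _ _) XL.
    - rewrite cRU edgesC //; apply: unmatched_sparse => //; first by rewrite edgesC.
      rewrite edgesC //; apply: (sparse _ _ _ UZ U'e XU); exact: setSD.
    - by move: cRE smallE; rewrite cR; clear; lia.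
  have IJ : #|I| + #|J| <= #|E| + #|rich G g1 N X' Y' E|.
    have -> : rich G g1 N X' Y' E = I :&: J.
      by apply/setP => e; rewrite !inE; case: (e \in E).
    rewrite -cardsUI leq_add2r subset_leq_card //.
    by apply/subsetP => e; rewrite !inE => /orP[]/andP[].
  have ri9 : 9 * #|rich G g1 N X' Y' E| < N.
    by apply: leq_ltn_trans ri; rewrite leq_mul2r leq_pmulr ?orbT.
  apply: (count_arith MN _ _ smallE _ _ IJ ri9 (x := #|Y|) (y := #|X|)).
  - by move: cY RU; clear; lia.
  - by move: cX LU; clear; lia.
  - by rewrite -cI ltn_add2r.
  - by rewrite -cJ ltn_add2r.
apply: cyc.
  by apply: leq_trans Nk _; rewrite leq_mul2r leq_pmull ?orbT.
have : h * N <= h * (#|E| + M) by rewrite leq_mul2l bigE orbT.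
by move: kN; rewrite /g1; clear; lia.
Qed.

(** * Two colours *)

(** If the maximal packing inside [U] is too small, take the unmatched part of [U :&: L] and of all
    of [R]: the latter is unmatched in [U], hence sparse by maximality, or lies outside [U], hence
    sparse by the boundary. Little is lost on the left because [U] covers almost all of [L]. *)
Lemma cycle_or_sparse H D g : 0 < H -> 0 < g -> exists N0, forall N, N0 <= N ->
  forall (V : finType) (G : rel V) (side : V -> bool) (L R U : {set V}) f,
  symmetric G -> (forall x y, G x y -> side x != side y) -> separated side L R ->
  #|L| <= N -> #|R| <= N -> linked G D f U -> N <= g * f ->
  H * #|L :\: U| <= N -> H * edges G U ((L :|: R) :\: U) <= N ^ 2 ->
  forall k, N <= H * k -> has_cycle G k \/ exists S T : {set V},
    [/\ S \subset L, T \subset R, H * #|L| <= H * #|S| + H * k + 3 * N,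
      H * #|R| <= H * #|T| + H * k + 3 * N & H * edges G S T <= 2 * N ^ 2].
Proof.
move=> H0 g0; have [N0 pc] := packing_cycle D H0 g0.
exists N0 => N leN V G side L R U f symG bip sep cL cR lkU Nf LU eU k Nk.
pose X := U :&: L; pose Y := U :&: R.
have XL : X \subset L by exact: subsetIr.
have YR : Y \subset R by exact: subsetIr.
have XU : X \subset U by exact: subsetIl.
have YU : Y \subset U by exact: subsetIl.
have [sX sY] := separated_sub XL YR sep.
have [||E [EXY [inj1 inj2] unm _ cyc]] :=
   pc N leN V G side U X Y f symG bip lkU Nf XU YU sX sY.
- exact: leq_trans (subset_leq_card XL) cL.
- exact: leq_trans (subset_leq_card YR) cR.
have [bigE|smallE] := leqP (H * k + N) (H * #|E|); [left; exact: cyc|right].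
have E1 := imset_fst_sub EXY; have E2 := imset_snd_sub EXY.
have cX := card_setI_setD U L.
have cXE := card_unmatched inj1 E1 (subxx E).
have cRE := card_unmatched inj2 (subset_trans E2 YR) (subxx E).
exists (X :\: fst @: E), (R :\: snd @: E); split.
- exact: subset_trans (subsetDl _ _) XL.
- exact: subsetDl.
- rewrite -cX -/X -cXE !mulnDr; move: smallE LU; clear; lia.
- rewrite -cRE mulnDr; move: smallE; clear; lia.
have sub : R :\: snd @: E \subset (Y :\: snd @: E) :|: ((L :|: R) :\: U).
  apply/subsetP => x; rewrite /Y !inE => /andP[-> ->].
  by case: (x \in U); rewrite ?orbT.
have : edges G (X :\: fst @: E) (R :\: snd @: E) <=
    edges G (X :\: fst @: E) (Y :\: snd @: E) + edges G U ((L :|: R) :\: U).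
  apply: leq_trans (edges_subset _ (subxx _) sub) _.
  apply: leq_trans (edgesUr_le symG _ _ _) _; rewrite leq_add2l.
  by apply: edges_subset => //; apply: subset_trans (subsetDl _ _) XU.
move=> /(leq_mul (leqnn H)); rewrite mulnDr.
by move: unm eU; move: (N ^ 2) => y; clear; lia.
Qed.

Lemma dense_of_nearly (V : finType) (G : rel V) c g N (S T : {set V}) :
  0 < g -> 2 * c ^ 2 <= g -> nearly G g N S T -> N <= c * #|S| -> N <= c * #|T| ->
  N ^ 2 <= 2 * c ^ 2 * edges G S T.
Proof.
move=> g0 cg /(_ S T (subxx _) (subxx _)) nr NS NT.
have : N ^ 2 <= c ^ 2 * (#|S| * #|T|).
  by rewrite -!mulnn mulnACA leq_mul.
move: nr cg; move: (#|S| * #|T|) (edges _ _ _) (N ^ 2) (c ^ 2) => x e n c2 nr cg h.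
rewrite -(leq_pmul2l g0).
have : g * n <= g * (c2 * x) by rewrite leq_mul2l h orbT.
have : c2 * (g * x) <= c2 * (g * e + n) by rewrite leq_mul2l nr orbT.
have : 2 * c2 * n <= g * n by rewrite leq_mul2r cg orbT.
by rewrite mulnDr; clear; lia.
Qed.

(** Vertices of [A] missed by [U] are joined to almost all of [U :&: B], and these edges lie in the
    sparse boundary. *)
Lemma nearly_absorb (V : finType) (G : rel V) C g N (A B U Z : {set V}) :
  symmetric G -> 0 < N -> A \subset Z -> nearly G g N A B -> N <= C * #|U :&: B| ->
  g * edges G U (Z :\: U) <= N ^ 2 -> g * #|A :\: U| <= C * 2 * N.
Proof.
move=> symG N0 AZ nr NB eU; apply: prod_small N0 NB _.
have := nr (A :\: U) (U :&: B) (subsetDl _ _) (subsetIr _ _).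
rewrite (mulnC #|U :&: B|) => /leq_trans; apply.
have : g * edges G (A :\: U) (U :&: B) <= N ^ 2.
  apply: leq_trans eU; rewrite leq_mul2l edgesC //.
  by rewrite edges_subset ?orbT // ?subsetIl // setSD.
by move: (N ^ 2) => n; clear; lia.
Qed.

(** The 13 is 16 - 3: a slack of [N / h] minus the loss [3 * N / H] in [cycle_or_sparse] leaves
    sides of at least [13 N / (16 h)]. A nearly complete rectangle of that size cannot be sparse. *)
Lemma nearly_contra h C H g N s t e : 0 < h -> 0 < C -> 0 < N -> H = 16 * h ^ 2 ->
  g = 2 * (C * H) -> 13 * N <= 16 * (h * s) -> 13 * N <= 16 * (h * t) ->
  g * (s * t) <= g * e + N ^ 2 -> H * e <= 2 * N ^ 2 -> False.
Proof.
move=> h0 C0 N0 HE gE hs ht nr sp.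
have H0 : 0 < H by rewrite HE muln_gt0 expn_gt0 h0.
have gH : 2 * H <= g by rewrite gE leq_mul2l /= leq_pmull.
have g0 : 0 < g by rewrite (leq_trans _ gH) // muln_gt0 H0.
have n0 : 0 < N ^ 2 by rewrite expn_gt0 N0.
have st : 169 * N ^ 2 <= 16 * H * (s * t).
  have -> : 169 * N ^ 2 = 13 * N * (13 * N) by rewrite -mulnn; clear; lia.
  have -> : 16 * H * (s * t) = 16 * (h * s) * (16 * (h * t)).
    by rewrite HE -mulnn; clear; lia.
  exact: leq_mul.
move: nr sp st n0; move: (N ^ 2) (s * t) => n x nr sp st n0.
have : g * (169 * n) <= g * (16 * H * x) by rewrite leq_mul2l st orbT.
have : 16 * H * (g * x) <= 16 * H * (g * e + n) by rewrite leq_mul2l nr orbT.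
have : 16 * g * (H * e) <= 16 * g * (2 * n) by rewrite leq_mul2l sp orbT.
have : 8 * n * (2 * H) <= 8 * n * g by rewrite leq_mul2l gH orbT.
have : 0 < g * n by rewrite muln_gt0 g0.
rewrite mulnDr; clear; lia.
Qed.

Lemma cycle_of_nearly h : 0 < h -> exists2 g, 0 < g & exists N0, forall N, N0 <= N ->
  forall (V : finType) (G : rel V) (side : V -> bool) (S T : {set V}),
  symmetric G -> (forall x y, G x y -> side x != side y) -> separated side S T ->
  #|S| <= N -> #|T| <= N -> nearly G g N S T ->
  forall k, N <= h * k -> h * k + N <= h * #|S| -> h * k + N <= h * #|T| ->
  has_cycle G k.
Proof.
move=> h0; have h20 : 0 < 2 * h ^ 2 by rewrite muln_gt0 expn_gt0 h0.
have [C C0 hub] := hub_grow h20.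
pose H := 16 * h ^ 2; have H0 : 0 < H by rewrite muln_gt0 expn_gt0 h0.
pose g := 2 * (C * H); have g0 : 0 < g by rewrite muln_gt0 /= muln_gt0 C0 H0.
exists g => //; have [D [g2 [N1 [g20 hubg]]]] := hub g g0.
have [N2 alt] := cycle_or_sparse D H0 g20.
exists (N1 + N2).+1 => N leN V G side S T symG bip sep cS cT nr k Nk kS kT.
have N0 : 0 < N by apply: leq_trans leN.
have leN1 : N1 <= N by apply: leq_trans leN; rewrite leqW // leq_addr.
have leN2 : N2 <= N by apply: leq_trans leN; rewrite leqW // leq_addl.
have Hg : H <= g by rewrite /g mulnA leq_pmull // muln_gt0.
have NS : N <= h * #|S| by apply: leq_trans kS; rewrite leq_addl.
have NT : N <= h * #|T| by apply: leq_trans kT; rewrite leq_addl.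
have dense : N ^ 2 <= 2 * h ^ 2 * edges G S T.
  apply: dense_of_nearly g0 _ nr NS NT; apply: leq_trans Hg.
  by rewrite /H leq_mul2r orbT.
pose Z := S :|: T.
have [|||U [f [UZ [lkU Nf] US UT eU]]] :=
    hubg N leN1 V G S T Z symG _ _ cS cT _ dense.
- exact: subsetUl.
- exact: subsetUr.
- by apply: leq_trans (leq_card_setU _ _) _; rewrite mul2n -addnn leq_add.
have SU : H * #|S :\: U| <= N.
  have C20 : 0 < 2 * C by rewrite muln_gt0.
  rewrite -(leq_pmul2l C20) mulnA -[2 * C * H]mulnA -/g (mulnC 2 C).
  by apply: nearly_absorb symG N0 _ nr UT eU; exact: subsetUl.
have eU' : H * edges G U (Z :\: U) <= N ^ 2.
  by apply: leq_trans eU; rewrite leq_mul2r Hg orbT.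
have NHk : N <= H * k.
  apply: leq_trans Nk _; rewrite leq_mul2r; apply/orP; right.
  by rewrite /H -mulnn mulnA leq_pmull // muln_gt0.
have [//|[S' [T' [S'S T'T lS lT sp]]]] :=
  alt N leN2 V G side S T U f symG bip sep cS cT lkU Nf SU eU' k NHk.
have big s s' : h * k + N <= h * s -> H * s <= H * s' + H * k + 3 * N -> 13 * N <= 16 * (h * s').
  move=> h1 h2.
  have h3 : 16 * h * (h * k + N) <= 16 * h * (h * s) by rewrite leq_mul2l h1 orbT.
  have h4 : 3 * N <= h * (3 * N) by rewrite leq_pmull.
  rewrite -(leq_pmul2l h0); move: h2 h3 h4; rewrite /H -mulnn; clear; lia.
by case: (nearly_contra h0 C0 N0 (erefl H) (erefl g) (big _ _ kS lS) (big _ _ kT lT) (nr _ _ S'S T'T) sp).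
Qed.

(** Without the first cycle, [cycle_or_sparse] yields a rectangle with sides about [N - a], slightly
    above [b], where the second colour is nearly complete. [H] and [g] precede [D] and [g2] because
    [U] is grown only after its required precision is known. *)
Lemma two_colour_finish h : 0 < h -> exists H g, [/\ 0 < H, 0 < g &
  forall D g2, 0 < g2 -> exists N0, forall N, N0 <= N ->
  forall (V : finType) (G1 G2 : rel V) (side : V -> bool) (L R U : {set V}) f,
  symmetric G1 -> symmetric G2 -> (forall x y, G1 x y -> side x != side y) ->
  (forall x y, G2 x y -> side x != side y) -> separated side L R ->
  #|L| = N -> #|R| = N -> linked G1 D f U -> N <= g2 * f ->
  H * #|L :\: U| <= N -> H * edges G1 U ((L :|: R) :\: U) <= N ^ 2 ->
  covered G1 G2 g N L R ->
  forall a b, N <= h * a -> N <= h * b -> h * (a + b) + N <= h * N ->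
  has_cycle G1 a \/ has_cycle G2 b].
Proof.
move=> h0; have h40 : 0 < 4 * h by rewrite muln_gt0.
have [gN gN0 [N1 nc]] := cycle_of_nearly h40.
pose w := 16 * gN; pose H := w * h.
have H0 : 0 < H by rewrite !muln_gt0 gN0.
exists H, (2 * gN); split=> //; first by rewrite muln_gt0.
move=> D g2 g20; have [N2 alt] := cycle_or_sparse D H0 g20.
exists (N1 + N2) => N leN V G1 G2 side L R U f sym1 sym2 bip1 bip2 sep cL cR lkU Nf LU eU cov a b Na Nb abN.
have leN1 : N1 <= N by apply: leq_trans leN; rewrite leq_addr.
have leN2 : N2 <= N by apply: leq_trans leN; rewrite leq_addl.
have NHa : N <= H * a.
  by apply: leq_trans Na _; rewrite leq_mul2r leq_pmull ?orbT // muln_gt0.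
have lL : #|L| <= N by rewrite cL.
have lR : #|R| <= N by rewrite cR.
have [|[S [T [SL TR lS lT sp]]]] :=
  alt N leN2 V G1 side L R U f sym1 bip1 sep lL lR lkU Nf LU eU a NHa; first by left.
right; rewrite cL in lS; rewrite cR in lT.
have big s : H * N <= H * s + H * a + 3 * N -> 4 * h * b + N <= 4 * h * s.
  move=> h1; have w0 : 0 < w by rewrite muln_gt0.
  rewrite -(leq_pmul2l w0).
  have : w * (h * (a + b) + N) <= w * (h * N) by rewrite leq_mul2l abN orbT.
  have : 16 * N <= w * N by rewrite leq_mul2r leq_pmulr ?orbT.
  by move: h1; rewrite /H; move: (w) => w'; clear; lia.
apply: (nc N leN1 V G2 side S T) => //.
- exact: separated_sub SL TR sep.
- by rewrite -cL subset_leq_card.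
- by rewrite -cR subset_leq_card.
- apply: covered_sparse sym1 _ _; first exact: covered_sub SL TR cov.
  have : 2 * (2 * gN * edges G1 S T) <= H * edges G1 S T.
    rewrite mulnA leq_mul2r; apply/orP; right; rewrite /H /w mulnA.
    by apply: leq_trans (leq_pmulr _ h0); rewrite leq_mul2r orbT.
  by move: sp; move: (N ^ 2) => n; clear; lia.
- by apply: leq_trans Nb _; rewrite -mulnA leq_pmull.
- exact: big.
- exact: big.
Qed.

(** [U] grows from [P x Q] and absorbs [P]. If it contained little of [Q'], the edges between [P]
    and [Q'] would overfill its boundary; so it contains much of [Q'] and absorbs [P'] as well. *)
Lemma connected_across C1 g3 H : 0 < C1 -> 0 < g3 -> 0 < H -> exists2 g, 0 < g &
  exists D g2 N0, 0 < g2 /\ forall N, N0 <= N ->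
  forall (V : finType) (G : rel V) (P Q P' Q' Z : {set V}), symmetric G ->
  P \subset Z -> Q \subset Z -> P' \subset Z -> Q' \subset Z -> #|Z| <= 2 * N ->
  #|P| <= N -> #|Q| <= N -> #|Q'| <= N ->
  nearly G g N P Q -> nearly G g N P' Q' -> N <= C1 * #|P| -> N <= C1 * #|Q| ->
  N ^ 2 <= g3 * edges G P Q' ->
  exists (U : {set V}) f, [/\ linked G D f U, N <= g2 * f,
    H * (#|P :\: U| + #|P' :\: U|) <= N & H * edges G U (Z :\: U) <= N ^ 2].
Proof.
move=> C10 g30 H0; have h10 : 0 < 2 * C1 ^ 2 by rewrite muln_gt0 expn_gt0 C10.
have [C C0 hub] := hub_grow h10.
pose g := 2 * C1 ^ 2 * (8 * (H * (C * g3))).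
have X0 : 0 < H * (C * g3) by rewrite !muln_gt0 H0 C0.
have g0 : 0 < g by rewrite muln_gt0 h10 muln_gt0.
exists g => //; have [D [g2 [N1 [g20 hubg]]]] := hub g g0.
exists D, g2, N1.+1; split=> // N leN V G P Q P' Q' Z symG PZ QZ P'Z Q'Z cZ cP cQ cQ' nr nr' NP NQ dPQ'.
have N0 : 0 < N by apply: leq_trans leN.
have leN1 : N1 <= N by exact: ltnW.
have gbig : 8 * (H * (C * g3)) <= g by rewrite leq_pmull.
have dense : N ^ 2 <= 2 * C1 ^ 2 * edges G P Q.
  apply: dense_of_nearly g0 _ nr NP NQ; rewrite /g leq_pmulr // muln_gt0 X0 //.
have [U [f [UZ [lkU Nf] UP UQ eU]]] := hubg N leN1 V G P Q Z symG PZ QZ cP cQ cZ dense.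
have PU : g * #|P :\: U| <= C * 2 * N by exact: nearly_absorb symG N0 PZ nr UQ eU.
have CgX : C * g3 <= H * (C * g3) by rewrite leq_pmull.
have Cg1 : C <= C * g3 by rewrite leq_pmulr.
have Cg2 : g3 <= C * g3 by rewrite leq_pmull.
have NQ' : N <= 2 * g3 * #|U :&: Q'|.
  have e1 : edges G P Q' <= #|P :\: U| * N + (edges G U (Z :\: U) + N * #|U :&: Q'|).
    have -> : edges G P Q' = edges G (P :\: U) Q' + edges G (U :&: P) Q'.
      rewrite -edgesUl; last first.
        by rewrite -setI_eq0; apply/eqP/setP => x; rewrite !inE; case: (x \in U); rewrite ?andbF.
      congr edges; apply/setP => x; rewrite !inE.
      by case: (x \in U); rewrite /= ?orbF.
    apply: leq_add.
      by apply: leq_trans (edges_le _ _ _) _; rewrite leq_mul2l cQ' orbT.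
    apply: leq_trans (_ : edges G (U :&: P) ((Q' :\: U) :|: (U :&: Q')) <= _).
      apply: edges_subset => //; apply/subsetP => x; rewrite !inE => ->.
      by case: (x \in U); rewrite ?orbT.
    apply: leq_trans (edgesUr_le symG _ _ _) _; apply: leq_add.
      by apply: edges_subset; rewrite ?subsetIl ?setSD.
    apply: leq_trans (edges_le _ _ _) _; rewrite leq_mul2r; apply/orP; right.
    by apply: leq_trans cP; rewrite subset_leq_card ?subsetIr.
  have e2 : g * N ^ 2 <= g * (g3 * (#|P :\: U| * N + (edges G U (Z :\: U) + N * #|U :&: Q'|))).
    by rewrite leq_mul2l; apply/orP; right; apply: leq_trans dPQ' _; rewrite leq_mul2l e1 orbT.
  have e3 : g3 * N * (g * #|P :\: U|) <= g3 * N * (C * 2 * N) by rewrite leq_mul2l PU orbT.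
  have e4 : g3 * (g * edges G U (Z :\: U)) <= g3 * N ^ 2 by rewrite leq_mul2l eU orbT.
  have e5 : g3 * (C * 2) + g3 <= 3 * (H * (C * g3)).
    by move: CgX Cg2; clear; lia.
  have e6 : 2 * N * N * (g3 * (C * 2) + g3) <= N * N * g.
    apply: leq_trans (_ : N * N * (8 * (H * (C * g3))) <= _); last by rewrite leq_mul2l gbig orbT.
    by have := leq_mul (leqnn (N * N)) e5; clear; lia.
  have gN0 : 0 < g * N by rewrite muln_gt0 g0.
  rewrite -(leq_pmul2l gN0); move: e2 e3 e4 e6; rewrite -!mulnn.
  move: (g) #|P :\: U| (edges _ _ _) #|U :&: Q'| => g' x e y; clear; lia.
have P'U : g * #|P' :\: U| <= 2 * g3 * 2 * N by exact: nearly_absorb symG N0 P'Z nr' NQ' eU.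
exists U, f; split=> //.
  rewrite -(leq_pmul2l g0).
  have : H * (g * #|P :\: U|) <= H * (C * 2 * N) by rewrite leq_mul2l PU orbT.
  have : H * (g * #|P' :\: U|) <= H * (2 * g3 * 2 * N) by rewrite leq_mul2l P'U orbT.
  have : 8 * (H * (C * g3)) * N <= g * N by rewrite leq_mul2r gbig orbT.
  have : H * N * C <= H * N * (C * g3) by rewrite leq_mul2l Cg1 orbT.
  have : H * N * g3 <= H * N * (C * g3) by rewrite leq_mul2l Cg2 orbT.
  move: (g) #|P :\: U| #|P' :\: U| (C * g3) => g' x y z; clear; lia.
apply: leq_trans eU; rewrite leq_mul2r; apply/orP; right.
apply: leq_trans gbig; rewrite mulnCA leq_pmulr // muln_gt0 /= muln_gt0 C0.
by [].
Qed.

(** For a chequered two-by-two splitting: the first two cases are the rectangles of one colour, with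
    room for [A], the last two those of the other colour, with room for [B]. *)
Lemma four_rectangles A B T X X' Y Y' : A + B <= T -> X + X' = T -> Y + Y' = T ->
  [\/ A <= X /\ A <= Y, A <= X' /\ A <= Y', B <= X /\ B <= Y' | B <= X' /\ B <= Y].
Proof.
move=> AB hX hY.
have [h1|h1] := boolP ((A <= X) && (A <= Y)); first by constructor 1; case/andP: h1.
have [h2|h2] := boolP ((A <= X') && (A <= Y')); first by constructor 2; case/andP: h2.
have [h3|h3] := boolP ((B <= X) && (B <= Y')); first by constructor 3; case/andP: h3.
constructor 4; move: h1 h2 h3; rewrite !negb_and -!ltnNge.
by move=> /orP[]h1 /orP[]h2 /orP[]h3; split; lia.
Qed.

(** When [U] misses a good part of both sides, the second colour is nearly complete on [X1 x Y2] and
    [X2 x Y1]. If it also has many edges on [X1 x Y1] or [X2 x Y2], these merge both rectangles into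
    one component covering almost all of [L], and [two_colour_finish] applies with the colours
    exchanged. Otherwise the first colour is nearly complete on these two, and [four_rectangles]
    finds one large enough. *)
Lemma two_colours_dense h : 0 < h -> exists2 g, 0 < g & exists N0, forall N, N0 <= N ->
  forall (V : finType) (G1 G2 : rel V) (side : V -> bool) (L R : {set V}),
  symmetric G1 -> symmetric G2 -> (forall x y, G1 x y -> side x != side y) ->
  (forall x y, G2 x y -> side x != side y) -> separated side L R ->
  #|L| = N -> #|R| = N -> covered G1 G2 g N L R -> N ^ 2 <= 3 * edges G1 L R ->
  forall a b, N <= h * a -> N <= h * b -> h * (a + b) + N <= h * N ->
  has_cycle G1 a \/ has_cycle G2 b.
Proof.
move=> h0; have h40 : 0 < 4 * h by rewrite muln_gt0.
have [H [gF [H0 gF0 fin]]] := two_colour_finish h0.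
have [gN gN0 [N4 nc]] := cycle_of_nearly h40.
have [C C0 hub] := hub_grow (ltn0Sn 2).
have C10 : 0 < C * H by rewrite muln_gt0 C0.
have g30 : 0 < 2 * gN by rewrite muln_gt0.
have [g' g'0 [D' [g2' [N' [g2'0 conn]]]]] := connected_across C10 g30 H0.
pose gb := 2 * (g' * (gN * H)); have gb0 : 0 < gb by rewrite !muln_gt0 g'0 gN0.
have [D [g2 [N1 [g20 hubg]]]] := hub gb gb0.
have [N2 fin1] := fin D g2 g20; have [N3 fin2] := fin D' g2' g2'0.
pose g := 2 * (gF * (gN * g')); exists g; first by rewrite !muln_gt0 gF0 gN0.
exists (N1 + N2 + N3 + N4 + N').+1 => N leN V G1 G2 side L R sym1 sym2 bip1 bip2 sep cL cR cov dense a b Na Nb abN.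
have [leN1 leN2 leN3 leN4 leN'] : [/\ N1 <= N, N2 <= N, N3 <= N, N4 <= N & N' <= N].
  by move: leN; clear; split; lia.
have N0 : 0 < N by apply: leq_trans leN.
have gF_g : gF <= g by rewrite /g mulnCA leq_pmulr // !muln_gt0 gN0.
have gN_g : 2 * gN <= g by rewrite /g leq_mul2l /= mulnCA leq_pmulr // muln_gt0 gF0.
have g'_g : 2 * g' <= g by rewrite /g leq_mul2l /= mulnA leq_pmull // muln_gt0 gF0.
have H_gb : H <= gb by rewrite /gb !mulnA leq_pmull // !muln_gt0 g'0.
have g'_gb : 2 * g' <= gb by rewrite /gb leq_mul2l /= leq_pmulr // muln_gt0 gN0.
have gN_gb : 2 * gN <= gb by rewrite /gb leq_mul2l /= mulnCA leq_pmulr // muln_gt0 g'0.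
have dLR := separated_disjoint sep.
pose Z := L :|: R.
have LZ : L \subset Z by exact: subsetUl.
have RZ : R \subset Z by exact: subsetUr.
have lL : #|L| <= N by rewrite cL.
have lR : #|R| <= N by rewrite cR.
have lZ : #|Z| <= 2 * N.
  by apply: leq_trans (leq_card_setU _ _) _; rewrite mul2n -addnn leq_add.
have [U [f [UZ [lkU Nf] UL UR eU]]] := hubg N leN1 V G1 L R Z sym1 LZ RZ lL lR lZ dense.
have eUH : H * edges G1 U (Z :\: U) <= N ^ 2.
  by apply: leq_trans eU; rewrite leq_mul2r H_gb orbT.
have covF : covered G1 G2 gF N L R by exact: covered_le gF_g cov.
have [LU|LU] := leqP (H * #|L :\: U|) N.
  exact: (fin1 N leN2 V G1 G2 side L R U f).
have [RU|RU] := leqP (H * #|R :\: U|) N.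
  apply: (fin1 N leN2 V G1 G2 (fun x => ~~ side x) R L U f) => //.
  - by move=> x y /bip1; case: (side x) (side y) => [] [].
  - by move=> x y /bip2; case: (side x) (side y) => [] [].
  - exact: separatedC.
  - by rewrite setUC.
  - exact: coveredr.
pose X1 := U :&: L; pose X2 := L :\: U; pose Y1 := U :&: R; pose Y2 := R :\: U.
have cX : #|X1| + #|X2| = N by rewrite -cL card_setI_setD.
have cY : #|Y1| + #|Y2| = N by rewrite -cR card_setI_setD.
have X1L : X1 \subset L by exact: subsetIr.
have X2L : X2 \subset L by exact: subsetDl.
have Y1R : Y1 \subset R by exact: subsetIr.
have Y2R : Y2 \subset R by exact: subsetDl.
have bdry1 c : c <= gb -> c * edges G1 X1 Y2 <= N ^ 2.
  move=> cgb; apply: leq_trans eU; apply: leq_mul => //.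
  by apply: edges_subset; [exact: subsetIl|exact: setSD].
have bdry2 c : c <= gb -> c * edges G1 X2 Y1 <= N ^ 2.
  move=> cgb; apply: leq_trans eU; apply: leq_mul => //; rewrite edgesC //.
  by apply: edges_subset; [exact: subsetIl|exact: setSD].
have nrN12 : nearly G2 gN N X1 Y2.
  apply: covered_sparse sym1 _ (bdry1 _ gN_gb).
  by apply: covered_le gN_g _; exact: covered_sub cov.
have nrN21 : nearly G2 gN N X2 Y1.
  apply: covered_sparse sym1 _ (bdry2 _ gN_gb).
  by apply: covered_le gN_g _; exact: covered_sub cov.
have nr12 : nearly G2 g' N X1 Y2.
  apply: covered_sparse sym1 _ (bdry1 _ g'_gb).
  by apply: covered_le g'_g _; exact: covered_sub cov.
have nr21 : nearly G2 g' N X2 Y1.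
  apply: covered_sparse sym1 _ (bdry2 _ g'_gb).
  by apply: covered_le g'_g _; exact: covered_sub cov.
have CH x : N <= C * x -> N <= C * H * x.
  by move=> /leq_trans; apply; rewrite leq_mul2r leq_pmulr ?orbT.
have HC x : N < H * x -> N <= C * H * x.
  by move=> /ltnW /leq_trans; apply; rewrite leq_mul2r leq_pmull ?orbT.
have NX1 := CH _ UL; have NY1 := CH _ UR; have NX2 := HC _ LU; have NY2 := HC _ RU.
have le_N (S T : {set V}) : S \subset T -> #|T| = N -> #|S| <= N.
  by move=> ST <-; exact: subset_leq_card.
have finish2 U' f' : linked G2 D' f' U' -> N <= g2' * f' ->
   H * (#|X1 :\: U'| + #|X2 :\: U'|) <= N -> H * edges G2 U' (Z :\: U') <= N ^ 2 ->
   has_cycle G1 a \/ has_cycle G2 b.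
  move=> lkU' Nf' XU' eU'.
  suff [] : has_cycle G2 b \/ has_cycle G1 a by [right|left].
  apply: (fin2 N leN3 V G2 G1 side L R U' f') => //; [|exact: coveredC|by rewrite (addnC b)].
  apply: leq_trans XU'; rewrite leq_mul2l; apply/orP; right.
  apply: leq_trans (leq_card_setU _ _); apply: subset_leq_card.
  by apply/subsetP => x; rewrite !inE => /andP[-> ->]; case: (x \in U).
have [d11|s11] := leqP (N ^ 2) (2 * gN * edges G2 X1 Y1).
  have [|||||||U' [f' [lkU' Nf' XU' eU']]] := conn N leN' V G2 X1 Y2 X2 Y1 Z sym2
     _ _ _ _ lZ _ _ _ nr12 nr21 NX1 NY2 d11.
  - exact: subset_trans LZ.
  - exact: subset_trans RZ.
  - exact: subset_trans LZ.
  - exact: subset_trans RZ.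
  - exact: le_N cL.
  - exact: le_N cR.
  - exact: le_N cR.
  exact: finish2 lkU' Nf' XU' eU'.
have [d22|s22] := leqP (N ^ 2) (2 * gN * edges G2 X2 Y2).
  have [|||||||U' [f' [lkU' Nf' XU' eU']]] := conn N leN' V G2 X2 Y1 X1 Y2 Z sym2
     _ _ _ _ lZ _ _ _ nr21 nr12 NX2 NY1 d22.
  - exact: subset_trans LZ.
  - exact: subset_trans RZ.
  - exact: subset_trans LZ.
  - exact: subset_trans RZ.
  - exact: le_N cL.
  - exact: le_N cR.
  - exact: le_N cR.
  by apply: finish2 lkU' Nf' _ eU'; rewrite (addnC #|X1 :\: U'|).
have nr11 : nearly G1 gN N X1 Y1.
  apply: covered_sparse sym2 _ (ltnW s11).
  by apply: coveredC; apply: covered_le gN_g _; exact: covered_sub cov.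
have nr22 : nearly G1 gN N X2 Y2.
  apply: covered_sparse sym2 _ (ltnW s22).
  by apply: coveredC; apply: covered_le gN_g _; exact: covered_sub cov.
have N4a : N <= 4 * h * a by apply: leq_trans Na _; rewrite -mulnA leq_pmull.
have N4b : N <= 4 * h * b by apply: leq_trans Nb _; rewrite -mulnA leq_pmull.
have [|||[hX hY]|[hX hY]|[hX hY]|[hX hY]] := @four_rectangles
  (4 * h * a + N) (4 * h * b + N) (4 * h * N)
  (4 * h * #|X1|) (4 * h * #|X2|) (4 * h * #|Y1|) (4 * h * #|Y2|).
- by move: abN; clear; lia.
- by rewrite -mulnDr cX.
- by rewrite -mulnDr cY.
- left; apply: (nc N leN4 V G1 side X1 Y1) => //.
  + exact: separated_sub sep.
  + exact: le_N cL.
  + exact: le_N cR.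
- left; apply: (nc N leN4 V G1 side X2 Y2) => //.
  + exact: separated_sub sep.
  + exact: le_N cL.
  + exact: le_N cR.
- right; apply: (nc N leN4 V G2 side X1 Y2) => //.
  + exact: separated_sub sep.
  + exact: le_N cL.
  + exact: le_N cR.
- right; apply: (nc N leN4 V G2 side X2 Y1) => //.
  + exact: separated_sub sep.
  + exact: le_N cL.
  + exact: le_N cR.
Qed.

Lemma two_colours h : 0 < h -> exists2 g, 0 < g & exists N0, forall N, N0 <= N ->
  forall (V : finType) (G1 G2 : rel V) (side : V -> bool) (L R : {set V}),
  symmetric G1 -> symmetric G2 -> (forall x y, G1 x y -> side x != side y) ->
  (forall x y, G2 x y -> side x != side y) -> separated side L R ->
  #|L| = N -> #|R| = N -> covered G1 G2 g N L R ->
  forall a b, N <= h * a -> N <= h * b -> h * (a + b) + N <= h * N ->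
  has_cycle G1 a \/ has_cycle G2 b.
Proof.
move=> h0; have [g g0 [N0 main]] := two_colours_dense h0.
exists (3 * g); first by rewrite muln_gt0.
exists N0 => N leN V G1 G2 side L R sym1 sym2 bip1 bip2 sep cL cR cov a b Na Nb abN.
have cov' : covered G1 G2 g N L R by apply: covered_le cov; rewrite leq_pmull.
have [d1|d1] := leqP (N ^ 2) (3 * edges G1 L R); first exact: (main N leN V G1 G2 side L R).
have d2 : N ^ 2 <= 3 * edges G2 L R.
  have : covered G1 G2 3 N L R by apply: covered_le cov; rewrite leq_pmulr.
  move=> /(_ L R (subxx _) (subxx _)); rewrite cL cR mulnn.
  by move: d1; move: (N ^ 2) => n; clear; lia.
suff [] : has_cycle G2 b \/ has_cycle G1 a by [right|left].
by apply: (main N leN V G2 G1 side L R) => //; [exact: coveredC|rewrite (addnC b)].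
Qed.

(** * Many colours *)

Lemma many_colours n h : 0 < h -> exists2 g, 0 < g & exists N0, forall N, N0 <= N ->
  forall (V : finType) (G : nat -> rel V) (side : V -> bool) (L R : {set V}),
  (forall i, symmetric (G i)) -> (forall i x y, G i x y -> side x != side y) ->
  separated side L R -> #|L| = N -> #|R| = N ->
  (forall S T : {set V}, S \subset L -> T \subset R ->
     g * (#|S| * #|T|) <= g * \sum_(i < n.+2) edges (G i) S T + N ^ 2) ->
  forall a : nat -> nat, (forall i, i < n.+2 -> N <= h * a i) ->
  (forall k, 2 <= k < n.+2 -> 4 * \sum_(i < k) a i <= a k) ->
  h * (\sum_(i < n.+2) a i) + N <= h * N ->
  exists2 i, i < n.+2 & has_cycle (G i) (a i).
Proof.
elim: n h => [|n IHn] h h0.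
  have [g g0 [N0 main]] := two_colours h0.
  exists g => //; exists N0 => N leN V G side L R sym bip sep cL cR cov a Na _ aN.
  have [||||c|c] := main N leN V (G 0) (G 1) side L R (sym 0) (sym 1) (bip 0) (bip 1)
      sep cL cR _ (a 0) (a 1).
  - by move=> S T SL TR; have := cov S T SL TR; rewrite !big_ord_recr big_ord0 /= add0n.
  - exact: Na.
  - exact: Na.
  - by move: aN; rewrite !big_ord_recr big_ord0 /= add0n.
  - by exists 0.
  - by exists 1.
have h40 : 0 < 4 * h by rewrite muln_gt0.
have [g' g'0 [N1 IH]] := IHn _ h40.
(* Since [N <= h * M], a rectangle with fewer than [N ^ 2 / hL] edges of the last colour has fewer
   than [M ^ 2 / (4 * g')]. Together with the at most [M ^ 2 / (2 * g')] missing edges allowed by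
   [g] below, this stays within the tolerance of the induction hypothesis. *)
pose hL := 4 * h * (h * g'); have hg0 : 0 < h * g' by rewrite muln_gt0 h0.
have hL0 : 0 < hL by rewrite muln_gt0 h40.
have [N2 big] := cycle_of_dense hL0.
pose g := 2 * h ^ 2 * g'; exists g; first by rewrite muln_gt0 g'0 muln_gt0 expn_gt0 h0.
exists (h * N1 + N2 + 16 * h) => N leN V G side L R sym bip sep cL cR cov a Na a4 aN.
have leN1 : h * N1 <= N by move: leN; clear; lia.
have leN2 : N2 <= N by move: leN; clear; lia.
have leN3 : 16 * h <= N by move: leN; clear; lia.
pose r := n.+2; pose s := \sum_(i < r) a i.
have a4s : 4 * s <= a r by apply: a4; rewrite ltnSn.
have sE : \sum_(i < r.+1) a i = s + a r by rewrite big_ord_recr.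
rewrite sE in aN.
(* [d] is a quarter of the slack [N / h]. Then [4 * M <= a r + N / h <= N], and the problem of size
   [M] has slack [d], at least [M / (4 * h)] even after rounding because [16 * h <= N]. *)
pose d := N %/ (4 * h); pose M := s + d.
have dle : 4 * h * d <= N by rewrite mulnC leq_trunc_div.
have dge : N < 4 * h * d + 4 * h by have := ltn_ceil N h40; rewrite mulSn -/d; clear; lia.
have MN : 4 * M <= N.
  rewrite -(leq_pmul2l h0) /M.
  have : h * (4 * s) <= h * a r by rewrite leq_mul2l a4s orbT.
  by move: dle aN; clear; lia.
have NhM : N <= h * M.
  apply: leq_trans (Na 0 isT) _; rewrite leq_mul2l /M; apply/orP; right.
  by rewrite /s big_ord_recl -addnA leq_addr.
have [dense|] := pselect (forall S T : {set V}, S \subset L -> T \subset R ->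
    M <= #|S| -> M <= #|T| -> N ^ 2 <= hL * edges (G r) S T).
  exists r; first exact: ltnSn.
  apply: (big N leN2 V (G r) side L R M) => //; first exact: bip.
    apply: leq_trans (Na r (ltnSn _)) _; rewrite leq_mul2r; apply/orP; right.
    by rewrite /hL -mulnA mulnCA leq_pmulr // muln_gt0.
  have : h * g' * (4 * h * (a r + M) + 3 * N) <= h * g' * (4 * h * N).
    rewrite leq_mul2l; apply/orP; right; rewrite /M.
    by move: aN dle; clear; lia.
  have : N <= h * g' * N by rewrite leq_pmull.
  by rewrite /hL; move: (h * g') => x; clear; lia.
move=> /existsNP[S0 /existsNP[T0 /not_implyP[S0L /not_implyP[T0R]]]].
move=> /not_implyP[MS0 /not_implyP[MT0 /negP]]; rewrite -ltnNge => sparse.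
have [S SS0 cS] := subset_card MS0; have [T TT0 cT] := subset_card MT0.
have SL := subset_trans SS0 S0L; have TR := subset_trans TT0 T0R.
have [|||||i ir cyc] := IH M _ V G side S T sym bip (separated_sub SL TR sep) cS cT _ a.
- by rewrite -(leq_pmul2l h0); apply: leq_trans leN1 NhM.
- move=> S' T' S'S T'T.
  have h20 : 0 < 2 * h ^ 2 by rewrite muln_gt0 expn_gt0 h0.
  rewrite -(leq_pmul2l h20).
  have := cov S' T' (subset_trans S'S SL) (subset_trans T'T TR).
  rewrite big_ord_recr /= -/r.
  have : hL * edges (G r) S' T' <= hL * edges (G r) S0 T0.
    rewrite leq_mul2l; apply/orP; right.
    by apply: edges_subset; [exact: subset_trans SS0|exact: subset_trans TT0].
  have : N ^ 2 <= h ^ 2 * M ^ 2 by rewrite -expnMn leq_exp2r.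
  move: sparse; rewrite /hL /g.
  have -> : 4 * h * (h * g') = 4 * h ^ 2 * g' by rewrite -mulnn; clear; lia.
  move: (h ^ 2) (M ^ 2) (N ^ 2) (#|S'| * #|T'|) (edges (G r) S0 T0) (edges (G r) S' T').
  by move: (\sum_(i < n.+2) _) => e h2 m2 n2 x y z; clear; lia.
- move=> i ir; apply: leq_trans (_ : N <= _); first by move: MN; clear; lia.
  by apply: leq_trans (Na i _) _; [exact: leqW|rewrite -mulnA leq_pmull].
- by move=> k /andP[k2 kr]; apply: a4; rewrite k2 leqW.
- by rewrite -/r -/s {2}/M mulnDr leq_add2l; move: MN dge leN3; clear; lia.
by exists i => //; exact: leqW.
Qed.

Lemma has_copy_of_cycle (G : sgraph) k : has_cycle (@edge G) k ->
  has_copy G (cycle_graph (2 * k)).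
Proof.
move=> [c [cyc uc sc]].
case: c cyc uc sc => [|x0 c'] cyc uc sc.
  have k0 : k = 0 by move: sc; clear; case: k.
  by subst k; exists (fun u : 'I_(2 * 0) => False_rect _ (notF (ltn_ord u))); case.
set c := x0 :: c' in cyc uc sc *.
have step (u v : 'I_(2 * k)) : u.+1 %% (2 * k) == v -> edge (nth x0 c u) (nth x0 c v).
  move=> /eqP uv; have uc' : u < size c by rewrite sc.
  have := next_cycle cyc (mem_nth x0 uc').
  rewrite next_nth mem_nth // index_uniq // {2}/c.
  suff -> : nth x0 c' u = nth x0 c v by [].
  (* [next_nth] reads in the tail [c']; at the last vertex it falls on the default [x0], which is
     the head of [c]. *)
  rewrite -uv; have : u.+1 <= 2 * k by [].
  rewrite leq_eqVlt => /orP[/eqP uE|ult]; last by rewrite modn_small.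
  have sc' : size c' = u by apply: succn_inj; rewrite uE -sc.
  by rewrite uE modnn /= nth_default ?sc'.
exists (fun u : 'I_(2 * k) => nth x0 c u).
  by move=> u v /eqP; rewrite nth_uniq ?sc // => /eqP/val_inj.
by move=> u v /andP[_ /orP[/step|/step]]; rewrite // edge_sym.
Qed.

(** * Lower bound *)

Section LowerBound.
Variables (N r k : nat) (i0 i : 'I_r) (col : 'I_N -> 'I_r).

Definition left_color (u v : Knn N) : 'I_r :=
  match u, v with
  | inl x, inr _ | inr _, inl x => col x
  | _, _ => i0
  end.

Lemma left_color_sym u v : left_color u v = left_color v u.
Proof. by case: u v => x [] y. Qed.

Definition left_coloring := Coloring left_color_sym.

(** The successor of a right vertex on the cycle is a left vertex, so at least half of the [2 * k]
    vertices are on the left, and each of those has colour [i]. *)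
Lemma left_coloring_copy : 2 <= k ->
  has_copy (color_class left_coloring i) (cycle_graph (2 * k)) ->
  k <= #|[set x | col x == i]|.
Proof.
move=> k2 [f finj fedge].
have next_edge u : color_rel left_coloring i (f u) (f (ordS u)).
  apply: fedge; rewrite /= /cycle_rel /= eqxx /= andbT.
  apply/eqP => /(congr1 val) /= e; have ul := ltn_ord u.
  move: ul; rewrite leq_eqVlt => /orP[/eqP uE|ult].
    by rewrite uE modnn in e; move: uE k2; rewrite e; clear; lia.
  by rewrite modn_small // in e; move: e; clear; lia.
pose isl (v : Knn N) := if v is inl _ then true else false.
pose P := [set u | isl (f u)].
have PS : [set ordS u | u in ~: P] \subset P.
  apply/subsetP => _ /imsetP[u + ->]; rewrite !inE.
  by have := next_edge u; rewrite /color_rel /=; case: (f u) (f (ordS u)) => x [] y.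
have kP : k <= #|P|.
  have le : #|~: P| <= #|P| by rewrite -(card_imset _ (@ordS_inj _)) subset_leq_card.
  have : #|P| + #|~: P| = 2 * k by rewrite cardsC card_ord.
  by move: le; move: #|P| #|~: P| => x y; clear; lia.
apply: leq_trans kP _.
have sub : f @: P \subset [set inl x | x in [set x | col x == i]].
  apply/subsetP => _ /imsetP[u + ->]; rewrite inE.
  have := next_edge u; rewrite /color_rel /=; case: (f u) (f (ordS u)) => x [] y //=.
  by move=> /eqP xi _; apply/imsetP; exists x; rewrite ?inE ?xi.
have := subset_leq_card sub; rewrite card_imset // card_imset //.
by move=> x y [].
Qed.
End LowerBound.

(** Inject ['I_N] into the disjoint union of the ['I_(b i)] and read off the index. *)
Lemma exists_sized_classes N r (b : 'I_r -> nat) : N <= \sum_i b i ->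
  exists col : 'I_N -> 'I_r, forall i, #|[set x | col x == i]| <= b i.
Proof.
move=> Nb; pose T := {i : 'I_r & 'I_(b i)}.
have cT : #|{: T}| = \sum_i b i.
  rewrite card_tagged sumnE big_map big_enum /=.
  by apply: eq_bigr => i _; rewrite card_ord.
have NT : N <= #|{: T}| by rewrite cT.
pose e (x : 'I_N) : T := enum_val (widen_ord NT x).
have einj : injective e by move=> x y /enum_val_inj/(congr1 val)/= /val_inj.
exists (fun x => tag (e x)) => i.
rewrite -(card_imset _ einj) -[b i]card_ord -cardsT.
rewrite -(card_imset [set: 'I_(b i)] (f := fun y => Tagged (fun i => 'I_(b i)) y : T)).
  apply: subset_leq_card; apply/subsetP => _ /imsetP[x + ->]; rewrite inE => /eqP.
  by case: (e x) => j y /= ji; subst j; apply/imsetP; exists y; rewrite ?inE.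
by move=> y z /eqP; rewrite -tag_eqE /tag_eq eqxx tagged_asE => /eqP.
Qed.

Lemma not_arrow N r (a : 'I_r -> nat) : 0 < r -> (forall i, 2 <= a i) ->
  N <= \sum_i (a i).-1 -> ~ ramsey_arrow (fun i => cycle_graph (2 * a i)) N.
Proof.
move=> r0 a2 /exists_sized_classes[col colb] arrow.
have [i /(left_coloring_copy (a2 i))] := arrow (left_coloring (Ordinal r0) col).
by rewrite leqNgt => /negP; apply; apply: leq_ltn_trans (colb i) _; rewrite ltn_predL (ltnW (a2 i)).
Qed.

(** * Upper bound for colourings of the complete bipartite graph *)

Definition on_left N (v : Knn N) := if v is inl _ then true else false.

Lemma sum_edges_coloring N r (c : coloring (Knn N) r) (S T : {set Knn N}) :
  separated (@on_left N) S T ->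
  \sum_(i < r) edges (color_rel c i) S T = #|S| * #|T|.
Proof.
move=> [Sl Tr]; rewrite /edges exchange_big /= -sum_nat_const.
apply: eq_bigr => x xS; under eq_bigr do rewrite degE.
rewrite exchange_big /= -sum1_card; apply: eq_bigr => y yT.
rewrite (bigD1 (c x y)) //= big1 ?addn0 => [|i ci].
  by have := Sl x xS; have := Tr y yT; rewrite /color_rel eqxx; case: (x) (y) => x' [] y'.
by rewrite /color_rel eq_sym (negbTE ci) andbF.
Qed.

Lemma arrow_even_cycles r h : 2 <= r -> 0 < h -> exists N0, forall N, N0 <= N ->
  forall a : nat -> nat, (forall i, i < r -> N <= h * a i) ->
  (forall k, 2 <= k < r -> 4 * \sum_(i < k) a i <= a k) ->
  h * (\sum_(i < r) a i) + N <= h * N ->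
  ramsey_arrow (fun i : 'I_r => cycle_graph (2 * a i)) N.
Proof.
case: r => [|[|n]] // _ h0; have [g g0 [N0 main]] := many_colours n h0.
exists N0 => N leN a Na a4 aN c.
pose L : {set Knn N} := [set v | @on_left N v].
pose R : {set Knn N} := [set v | ~~ @on_left N v].
(* [many_colours] takes a family indexed by [nat]; [inord] recovers the colours in range, and out of
   range it still yields a symmetric bipartite relation. *)
pose G i : rel (Knn N) := color_rel c (inord i).
have bip x y : edge x y -> @on_left N x != @on_left N y by case: x y => x [] y.
have sep : separated (@on_left N) L R by split=> x; rewrite inE.
have cL : #|L| = N.
  have -> : L = [set inl x | x in [set: 'I_N]].
    apply/setP => -[x|x]; rewrite inE /=; apply/esym.
      by apply/imsetP; exists x; rewrite ?inE.
    by apply/negP => /imsetP[].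
  by rewrite card_imset ?cardsT ?card_ord // => x y [].
have cR : #|R| = N.
  have RL : R = ~: L by apply/setP => v; rewrite !inE.
  by have := cardsC L; rewrite -RL card_sum card_ord cL => /addnI.
have [|||i ir cyc] := main N leN (Knn N) G (@on_left N) L R _ _ sep cL cR _ a Na a4 aN.
- by move=> i; exact: color_rel_sym.
- by move=> i x y /andP[/bip].
- move=> S T SL TR; have sepST := separated_sub SL TR sep.
  rewrite -(sum_edges_coloring c sepST).
  under [X in _ <= _ * X + _]eq_bigr do rewrite /G inord_val.
  exact: leq_addr.
exists (Ordinal ir); apply: has_copy_of_cycle.
by move: cyc; rewrite /G; have -> : inord i = Ordinal ir by apply/val_inj; rewrite /= inordK.
Qed.

(* Imported only here: classical_sets shadows the finset lemmas used above. *)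
From mathcomp Require Import all_classical all_reals all_analysis.

Import Order.TTheory GRing.Theory Num.Theory.
Import numFieldNormedType.Exports.
Local Open Scope classical_set_scope.
Local Open Scope ring_scope.

(** * Asymptotics *)

Lemma absz_floor_itv (R : realType) (x : R) : 0 <= x ->
  (`|Num.floor x|%N)%:R <= x < (`|Num.floor x|%N)%:R + 1.
Proof.
move=> x0; have f0 : 0 <= Num.floor x by rewrite floor_ge0.
have := floor_itv x; rewrite natr_absz ger0_norm //.
by rewrite intrD.
Qed.

Lemma fact_ge6 k : (2 <= k)%N -> (6 <= k.+1`!)%N.
Proof.
move=> k2; rewrite factS; apply: (@leq_mul 3 2) => //.
exact: leq_trans k2 (fact_geq k).
Qed.

Section Asymptotics.
Variables (R : realType) (r : nat) (alpha : 'I_r -> R).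
Hypothesis hr : (3 <= r)%N.
Hypothesis alpha_gt0 : forall k : 'I_r, (k < 2)%N -> 0 < alpha k.
Hypothesis alpha_ge : forall k : 'I_r, (2 <= k)%N ->
  ((k.+1)`!%:R - 1) * (\sum_(i < r | (i < k)%N) alpha i) <= alpha k.

(** A uniform bound makes all half-lengths linear in [n], as the condition [N <= h * a i] requires.
    Beyond the first two indices the growth factor is at least one, so induction applies. *)
Lemma alpha_lower_bound : exists2 mu, 0 < mu & forall k, mu <= alpha k.
Proof.
have r0 : (0 < r)%N by apply: leq_trans hr.
have r1 : (1 < r)%N by apply: leq_trans hr.
pose mu := Num.min (alpha (Ordinal r0)) (alpha (Ordinal r1)).
have mu0 : 0 < mu by rewrite lt_min !alpha_gt0.
exists mu => // k; have [n kn] := ubnP (k : nat).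
elim: n k kn => // n IHn k; rewrite ltnS => kn.
have [k2|k2] := ltnP k 2.
  case: (posnP k) => k0.
    by rewrite ge_min; apply/orP; left; rewrite le_eqVlt (_ : k = Ordinal r0) ?eqxx //; apply: val_inj.
  rewrite ge_min; apply/orP; right; rewrite le_eqVlt (_ : k = Ordinal r1) ?eqxx //.
  by apply: val_inj => /=; apply/eqP; rewrite eqn_leq k0 -ltnS k2.
apply: le_trans (alpha_ge k2).
have s0 : mu <= \sum_(i < r | (i < k)%N) alpha i.
  rewrite (bigD1 (Ordinal r0)) /= ?(leq_trans _ k2) //.
  rewrite -[mu]addr0 lerD //; first by rewrite ge_min lexx.
  apply: sumr_ge0 => i /andP[ik _]; apply: le_trans (ltW mu0) _.
  by apply: IHn; exact: leq_trans ik kn.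
have f1 : 1 <= (k.+1)`!%:R - 1 :> R.
  have := fact_ge6 k2; rewrite -(ler_nat R); lra.
by nra.
Qed.

Lemma alpha_ge5 (k : 'I_r) : (2 <= k)%N ->
  5 * (\sum_(i < r | (i < k)%N) alpha i) <= alpha k.
Proof.
move=> k2; apply: le_trans (alpha_ge k2).
have [mu mu0 amu] := alpha_lower_bound.
apply: ler_wpM2r.
  by apply: sumr_ge0 => i _; exact: le_trans (ltW mu0) (amu i).
by have := fact_ge6 k2; rewrite -(ler_nat R); lra.
Qed.

Definition half_length (n : nat) (i : 'I_r) : nat :=
  `|Num.floor (alpha i * n%:R)|%N.

Let s := \sum_(j < r) alpha j.

Lemma half_length_itv n i :
  (half_length n i)%:R <= alpha i * n%:R < (half_length n i)%:R + 1.
Proof.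
apply: absz_floor_itv; rewrite mulr_ge0 //.
by have [mu mu0 amu] := alpha_lower_bound; exact: le_trans (ltW mu0) (amu i).
Qed.

Lemma br_lower : \forall n \near \oo, s * n%:R - (2 * r)%:R <=
  (br (fun i : 'I_r => cycle_graph (2 * half_length n i)))%:R.
Proof.
have [mu mu0 amu] := alpha_lower_bound.
near=> n.
have a2 i : (2 <= half_length n i)%N.
  rewrite -ltnS -(ltr_nat R) -[X in _ < X]natr1.
  have /andP[_ lt] := half_length_itv n i.
  apply: le_lt_trans lt; have : 3 / mu <= n%:R by near: n; exact: nbhs_infty_ger.
  rewrite ler_pdivrMr // => h; have := amu i; have : 0 <= n%:R :> R by [].
  by move: h; move: n%:R => x; nra.
have r0 : (0 < r)%N by apply: leq_trans hr.
have [arrow _] := br_min r0 (fun i => bipartite_even_cycle (half_length n i)).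
move: arrow; set b := br _ => arrow.
have lt : (\sum_i (half_length n i).-1 < b)%N.
  by rewrite ltnNge; apply/negP => /(not_arrow r0 a2); apply.
apply: le_trans (_ : (\sum_i (half_length n i).-1)%:R <= _); last by rewrite ler_nat ltnW.
rewrite natr_sum /s mulr_suml.
(* Each colour loses at most one to the floor and one to the predecessor. *)
have -> : (2 * r)%:R = \sum_(i < r) 2 :> R.
  by rewrite sumr_const card_ord natrM mulr_natr.
rewrite -sumrB; apply: ler_sum => i _.
have /andP[_ lt1] := half_length_itv n i.
rewrite -subn1 natrB ?(leq_trans _ (a2 i)) //.
by move: lt1; move: (half_length n i)%:R => x; lra.
Unshelve. all: by end_near.
Qed.

Lemma br_upper d : 0 < d -> \forall n \near \oo,
  (br (fun i : 'I_r => cycle_graph (2 * half_length n i)))%:R <= (s + d) * n%:R.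
Proof.
move=> d0; have [mu mu0 amu] := alpha_lower_bound.
have r0 : (0 < r)%N by apply: leq_trans hr.
have s_mu : mu <= s.
  rewrite /s (bigD1 (Ordinal r0)) //= -[mu]addr0 lerD // sumr_ge0 // => i _.
  exact: le_trans (ltW mu0) (amu i).
(* The first term gives [N <= h * a i], the second the slack [h * (\sum a i) + N <= h * N], where
   [N] is about [(s + d) * n]; the factors 2 absorb the floors. *)
pose h := (Num.truncn (2 * (s + d) / mu + 2 * (s + d) / d)).+1.
have hgt : 2 * (s + d) / mu + 2 * (s + d) / d < h%:R by exact: truncnS_gt.
have p1 : 0 < 2 * (s + d) / mu by rewrite divr_gt0 //; lra.
have p2 : 0 < 2 * (s + d) / d by rewrite divr_gt0 //; lra.
have h1 : 2 * (s + d) <= h%:R * mu by rewrite -ler_pdivrMr //; lra.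
have h2 : 2 * (s + d) <= h%:R * d by rewrite -ler_pdivrMr //; lra.
have hpos : 0 < h%:R :> R by rewrite ltr0n.
have [N0 arrow] := @arrow_even_cycles r h (ltnW hr) (ltn0Sn _).
near=> n.
have n_mu : 2 <= mu * n%:R.
  rewrite mulrC -ler_pdivrMr //; near: n; exact: nbhs_infty_ger.
have n_d : 2 <= d * n%:R.
  rewrite mulrC -ler_pdivrMr //; near: n; exact: nbhs_infty_ger.
have n_N0 : N0%:R + 1 <= mu * n%:R.
  rewrite mulrC -ler_pdivrMr //; near: n; exact: nbhs_infty_ger.
pose N := `|Num.floor ((s + d) * n%:R)|%N.
have n0 : 0 <= n%:R :> R by [].
have sd0 : 0 <= (s + d) * n%:R by rewrite mulr_ge0 //; lra.
have /andP[N1 N2] := absz_floor_itv sd0; rewrite -/N in N1 N2.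
pose a (j : nat) := if insub j is Some i then half_length n i else 0%N.
have aE (i : 'I_r) : a i = half_length n i by rewrite /a valK.
have a_sum : (\sum_(i < r) a i)%:R <= s * n%:R.
  rewrite natr_sum /s mulr_suml; apply: ler_sum => i _; rewrite aE.
  by have /andP[] := half_length_itv n i.
apply: (le_trans _ N1); rewrite ler_nat.
have [_ ->//] := br_min r0 (fun i => bipartite_even_cycle (half_length n i)).
suff : ramsey_arrow (fun i : 'I_r => cycle_graph (2 * a i)) N.
  by under eq_fun do rewrite aE.
have smu_n : mu * n%:R <= s * n%:R by rewrite ler_wpM2r.
have dn0 : 0 <= d * n%:R by rewrite mulr_ge0 // ltW.
apply: arrow.
- by rewrite -(ler_nat R); lra.
- move=> i ir; rewrite (_ : i = Ordinal ir) // aE -(ler_nat R) natrM.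
  have /andP[_ lt] := half_length_itv n (Ordinal ir).
  have e1 : 2 * (s + d) * n%:R <= h%:R * mu * n%:R by rewrite ler_wpM2r.
  have e2 : mu * n%:R <= alpha (Ordinal ir) * n%:R by rewrite ler_wpM2r.
  have e3 : mu * n%:R <= 2 * (half_length n (Ordinal ir))%:R by lra.
  have e4 := ler_wpM2l (ltW hpos) e3.
  by lra.
- move=> k /andP[k2 kr]; rewrite -(ler_nat R) natrM; apply: ltW.
  rewrite (_ : k = Ordinal kr) // aE.
  have /andP[_ lt] := half_length_itv n (Ordinal kr).
  have k2' : (2 <= Ordinal kr)%N by [].
  (* Of the factor 5, four parts bound the smaller half-lengths; the fifth, at least [mu * n >= 2],
     covers the floor of [alpha k * n]. *)
  have a5 := alpha_ge5 k2'; rewrite /= in a5.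
  set t := \sum_(i < r | (i < k)%N) alpha i in a5.
  have sumk : (\sum_(i < k) a i)%:R <= t * n%:R.
    rewrite (big_ord_widen r (fun i => a i)) ?(ltnW kr) // natr_sum mulr_suml.
    apply: ler_sum => i _; rewrite aE.
    by have /andP[] := half_length_itv n i.
  have tmu : mu <= t.
    rewrite /t (bigD1 (Ordinal r0)) /= ?(leq_trans _ k2) //.
    rewrite -[mu]addr0 lerD // sumr_ge0 // => i _.
    exact: le_trans (ltW mu0) (amu i).
  have tn : mu * n%:R <= t * n%:R by rewrite ler_wpM2r.
  have a5n : 5 * t * n%:R <= alpha (Ordinal kr) * n%:R by rewrite ler_wpM2r.
  by lra.
- rewrite -(ler_nat R) natrD !natrM.
  have e1 := ler_wpM2l (ltW hpos) a_sum.
  have e2 := ler_wpM2l (ltW hpos) (ltW N2).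
  have e3 : 2 * (s + d) * n%:R <= h%:R * d * n%:R by rewrite ler_wpM2r.
  have e4 := ler_wpM2l (ltW hpos) n_d.
  by lra.
Unshelve. all: by end_near.
Qed.

End Asymptotics.

Theorem corollary1p4 (R : realType) (r : nat) (alpha : 'I_r -> R)
  (hr : (3 <= r)%N)
  (alpha_gt0 : forall k : 'I_r, (k < 2)%N -> 0 < alpha k)
  (alpha_ge : forall k : 'I_r, (2 <= k)%N ->
     ((k.+1)`!%:R - 1) * (\sum_(i < r | (i < k)%N) alpha i) <= alpha k) :
  exists2 e : nat -> R, e n @[n --> \oo] --> (0 : R) &
    \forall n \near \oo,
      (br (fun i : 'I_r =>
             cycle_graph (2 * `|Num.floor (alpha i * n%:R)|%N)%N))%:R
      = (\sum_(j < r) alpha j + e n) * n%:R.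
Proof.
pose b n := br (fun i : 'I_r => cycle_graph (2 * half_length alpha n i)).
exists (fun n => (b n)%:R / n%:R - \sum_(j < r) alpha j); last first.
  near=> n; have n0 : (n%:R : R) != 0 by rewrite pnatr_eq0 -lt0n; near: n; exact: nbhs_infty_gt.
  by rewrite addrC subrK divfK.
apply/cvgrPdist_le => d d0; near=> n.
have n0 : (0 : R) < n%:R by rewrite ltr0n; near: n; exact: nbhs_infty_gt.
have lo : (\sum_(j < r) alpha j) * n%:R - (2 * r)%:R <= (b n)%:R.
  by near: n; exact: br_lower.
have up : (b n)%:R <= (\sum_(j < r) alpha j + d) * n%:R.
  by near: n; exact: br_upper.
have rd : (2 * r)%:R <= d * n%:R.
  by rewrite mulrC -ler_pdivrMr //; near: n; exact: nbhs_infty_ger.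
rewrite sub0r normrN ler_norml lerBrDr lerBlDr ler_pdivlMr // ler_pdivrMr //.
by apply/andP; split; lra.
Unshelve. all: by end_near.
Qed.
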